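(* Let $K\ge 1$ and let $\mathbf{X}_1,\dots,\mathbf{X}_{n_1},\mathbf{X}_{n_1+1},\dots,\mathbf{X}_n$ be $\mathbb{R}^K$-valued i.i.d. random vectors, $\mathbf{X}_i=(X_{i,1},\dots,X_{i,K})'$, such that for all $k\in\{1,\dots,K\}$ the cumulative distribution function $F_k$ of $X_{1,k}$ is continuous. Assume that $n_1=n_1(n)$ satisfies $n_1/n\to t_1\in(0,1)$ as $n\to\infty$, and that the $K\times K$ matrix $\Sigma$ defined by $$\Sigma_{kk'}=4\operatorname{Cov}\big(F_k(X_{1,k}),F_{k'}(X_{1,k'})\big),\qquad 1\le k,k'\le K,$$ is positive definite. Then the test statistic $$S_n(n_1)=\mathbf{U}_n(n_1)'\,\hat\Sigma_n^{-1}\,\mathbf{U}_n(n_1)$$ converges in distribution, as $n\to\infty$, to a $\chi^2$ distribution with $K$ degrees of freedom.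
   Context: The prime denotes transposition and $\mathbf 1(\cdot)$ the indicator function. The vector $\mathbf{U}_n(n_1)=(U_{n,1}(n_1),\dots,U_{n,K}(n_1))'$ is defined by $$U_{n,k}(n_1)=\frac{1}{\sqrt{n n_1(n-n_1)}}\sum_{i=1}^{n_1}\sum_{j=n_1+1}^{n}\{\mathbf 1(X_{i,k}\le X_{j,k})-\mathbf 1(X_{j,k}\le X_{i,k})\}.$$ The empirical c.d.f. of the $k$th coordinate is $\hat F_{n,k}(t)=n^{-1}\sum_{j=1}^n\mathbf 1(X_{j,k}\le t)$, and $\hat\Sigma_n$ is the $K\times K$ matrix with entries $$\hat\Sigma_{n,kk'}=\frac4n\sum_{i=1}^n\{\hat F_{n,k}(X_{i,k})-1/2\}\{\hat F_{n,k'}(X_{i,k'})-1/2\},\qquad 1\le k,k'\le K.$$ The statistic is defined by the displayed formula whenever $\hat\Sigma_n$ is invertible; its value when $\hat\Sigma_n$ is singular may be set arbitrarily. *)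

(* Defs.v *)
From HB Require Import structures.
From mathcomp Require Import all_boot all_order all_algebra finmap.
From mathcomp Require Import all_classical all_reals all_analysis.
From mathcomp Require Import measurable_realfun.

Set Implicit Arguments.
Unset Strict Implicit.
Unset Printing Implicit Defensive.

Import Order.TTheory GRing.Theory Num.Theory.
Import numFieldNormedType.Exports.

Local Open Scope classical_set_scope.
Local Open Scope ring_scope.

Section iid.
Context d d' (T : measurableType d) (E : measurableType d') (R : realType).
Variables (P : probability T R) (X : nat -> {RV P >-> E}).

Definition mutually_independent :=
  forall (J : {fset nat}) (A : nat -> set E),
    (forall i, measurable (A i)) ->
    P (\bigcap_(i in [set` J]) (X i @^-1` A i)) =
    (\prod_(i <- J) P (X i @^-1` A i))%E.

Definition identically_distributed :=
  forall i (A : set E), measurable A ->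
    distribution P (X i) A = distribution P (X 0%N) A.

Definition iid := mutually_independent /\ identically_distributed.

End iid.

Definition cvg_in_distribution d (T : measurableType d) (R : realType)
    (P : probability T R) (Y : nat -> {RV P >-> R})
    (mu : probability (measurableTypeR R) R) :=
  forall x : R, {for x, continuous (fun y : R => mu `]-oo, y]%classic)} ->
    cdf (Y n) x @[n --> \oo] --> mu `]-oo, x]%classic.

Section product_probability.
Context d1 d2 (T1 : measurableType d1) (T2 : measurableType d2) (R : realType).
Variables (P1 : probability T1 R) (P2 : probability T2 R).

Definition product_prob : set (T1 * T2) -> \bar R := (P1 \x P2)%E.

HB.instance Definition _ := Measure.on product_prob.

Lemma product_prob_setT : product_prob [set: _] = 1%E.
Proof.
rewrite /product_prob -setXTT product_measure1E// -[RHS]mule1.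
by congr (_ * _)%E; exact: probability_setT.
Qed.

HB.instance Definition _ :=
  Measure_isProbability.Build _ _ _ product_prob product_prob_setT.

End product_probability.

Section chi_square.
Variable R : realType.
Local Notation RT := (measurableTypeR R).

Definition add_sqr (z : RT * RT) : RT := z.1 + z.2 ^+ 2.

Lemma measurable_add_sqr : measurable_fun [set: RT * RT] add_sqr.
Proof.
apply: (@measurable_funD _ _ R); first exact: measurable_fst.
apply: (@measurable_funX _ _ R); exact: measurable_snd.
Qed.

HB.instance Definition _ :=
  isMeasurableFun.Build _ _ _ _ add_sqr measurable_add_sqr.

(* The law of Z_1^2 + ... + Z_k^2 for independent standard normal Z_i. *)
Fixpoint chi_square (k : nat) : probability RT R :=
  if k is j.+1 then
    distribution (product_prob (chi_square j) (normal_prob (0 : R) 1)) add_sqr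
  else @dirac _ RT (0 : R) R.

End chi_square.

Definition posdefmx (R : realType) (K : nat) (A : 'M[R]_K) :=
  A^T = A /\ forall u : 'cV[R]_K, u != 0 -> 0 < (u^T *m A *m u) 0 0.

(* Observations are numbered from 0: [x i] stands for the (i+1)-st one, so the
   first n1 observations are those of index i < n1. *)
Section sample.
Context (R : realType) (K : nat).
Implicit Types (x : nat -> K.-tuple R) (n : nat) (k : 'I_K).

Definition change_point_vec x n (n1 : nat) : 'cV[R]_K := \col_k
  ((Num.sqrt (n%:R * n1%:R * (n%:R - n1%:R)))^-1 *
   \sum_(0 <= i < n1) \sum_(n1 <= j < n)
     ((tnth (x i) k <= tnth (x j) k)%R%:R -
      (tnth (x j) k <= tnth (x i) k)%R%:R)).

Definition ecdf x n k (t : R) : R :=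
  n%:R^-1 * \sum_(0 <= j < n) (tnth (x j) k <= t)%R%:R.

Definition hatSigma x n : 'M[R]_K := \matrix_(k, k')
  (4 / n%:R * \sum_(0 <= i < n)
     (ecdf x n k (tnth (x i) k) - 2^-1) *
     (ecdf x n k' (tnth (x i) k') - 2^-1)).

(* [c] is the value assigned to the statistic when [hatSigma] is singular. *)
Definition sample_stat x n (n1 : nat) (c : R) : R :=
  let U := change_point_vec x n n1 in
  if hatSigma x n \in unitmx then (U^T *m invmx (hatSigma x n) *m U) 0 0
  else c.

End sample.

Section measurable_matrix.
Context d (T : measurableType d) (R : realType).

Lemma measurable_invr : measurable_fun [set: R] (@GRing.inv R).
Proof.
have -> : @GRing.inv R = fun x => if x == 0 then 0 else x^-1.
  by apply/funext => x; case: eqP => // ->; rewrite invr0.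
apply: measurable_fun_if => //; first exact: measurable_fun_eqr.
rewrite setTI; apply: open_continuous_measurable_fun.
  rewrite (_ : _ @^-1` _ = ~` [set 0]); last first.
    by apply/seteqP; split => x /=; [move/eqP|move/eqP/negbTE].
  by apply: closed_openC; exact: closed_eq.
by move=> x; rewrite inE /= => /negbT x0; exact: inv_continuous.
Qed.

Lemma measurable_det n (A : T -> 'M[R]_n) :
  (forall i j, measurable_fun [set: T] (fun w => A w i j)) ->
  measurable_fun [set: T] (fun w => \det (A w)).
Proof.
move=> mA; rewrite /determinant; apply: measurable_sum => s.
by apply: measurable_funM => //; apply: measurable_prod => i _; exact: mA.
Qed.

Lemma measurable_mulmx m n p (A : T -> 'M[R]_(m, n)) (B : T -> 'M[R]_(n, p)) :
  (forall i j, measurable_fun [set: T] (fun w => A w i j)) ->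
  (forall i j, measurable_fun [set: T] (fun w => B w i j)) ->
  forall i j, measurable_fun [set: T] (fun w => (A w *m B w) i j).
Proof.
move=> mA mB i j; under eq_fun do rewrite mxE.
by apply: measurable_sum => k; apply: measurable_funM.
Qed.

Lemma measurable_unitmx n (A : T -> 'M[R]_n) :
  (forall i j, measurable_fun [set: T] (fun w => A w i j)) ->
  measurable_fun [set: T] (fun w => A w \in unitmx).
Proof.
move=> mA; under eq_fun do rewrite unitmxE unitfE.
apply: measurableT_comp => //.
by apply: measurable_fun_eqr => //; exact: measurable_det.
Qed.

Lemma measurable_invmx n (A : T -> 'M[R]_n) :
  (forall i j, measurable_fun [set: T] (fun w => A w i j)) ->
  forall i j, measurable_fun [set: T] (fun w => invmx (A w) i j).
Proof.
move=> mA i j; rewrite /invmx.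
under eq_fun do rewrite (fun_if (fun M : 'M[R]_n => M i j)).
apply: measurable_fun_ifT => //; first exact: measurable_unitmx.
under eq_fun do rewrite !mxE.
apply: measurable_funM.
  apply: (measurableT_comp measurable_invr); exact: measurable_det.
apply: measurable_funM => //; apply: measurable_det => k l.
under eq_fun do rewrite !mxE.
exact: mA.
Qed.

End measurable_matrix.

Section random_sample.
Context d (T : measurableType d) (R : realType) (P : probability T R) (K : nat).
Variable X : nat -> {RV P >-> K.-tuple R}.

Definition coord (i : nat) (k : 'I_K) (w : T) : R := tnth (X i w) k.

Lemma measurable_coord i k : measurable_fun [set: T] (coord i k).
Proof.
apply: (measurableT_comp (measurable_tnth k)).
exact: measurable_funPT.
Qed.

HB.instance Definition _ i k :=
  isMeasurableFun.Build _ _ _ _ (coord i k) (measurable_coord i k).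

Definition coord_rv i k : {RV P >-> R} := coord i k.

(* The variable F_k(X_{1,k}). *)
Definition grade (k : 'I_K) (w : T) : R :=
  fine (cdf (coord_rv 0 k) (coord_rv 0 k w)).

Definition Sigma : 'M[R]_K :=
  \matrix_(k, k') (4 * fine (covariance P (grade k) (grade k'))).

Variables (n1 : nat -> nat) (c : nat -> {RV P >-> R}).

Definition test_stat (n : nat) (w : T) : R :=
  sample_stat (fun i => X i w) n (n1 n) (c n w).

Lemma measurable_test_stat n : measurable_fun [set: T] (test_stat n).
Proof.
have mX i k : measurable_fun [set: T] (fun w => tnth (X i w) k).
  exact: measurable_coord.
have mb (f g : T -> R) : measurable_fun [set: T] f ->
    measurable_fun [set: T] g ->
    measurable_fun [set: T] (fun w => (f w <= g w)%R%:R : R).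
  move=> mf mg; under eq_fun do rewrite mulrb.
  by apply: measurable_fun_ifT => //; exact: measurable_fun_ler.
have mF k i : measurable_fun [set: T]
    (fun w => ecdf (X ^~ w) n k (tnth (X i w) k)).
  by apply: measurable_funM => //; apply: measurable_sum => j; exact: mb.
have mS i j : measurable_fun [set: T] (fun w => hatSigma (X ^~ w) n i j).
  under eq_fun do rewrite mxE.
  apply: measurable_funM => //; apply: measurable_sum => k.
  by apply: measurable_funM; apply: measurable_funB.
have mU k j : measurable_fun [set: T]
    (fun w => change_point_vec (X ^~ w) n (n1 n) k j).
  under eq_fun do rewrite mxE.
  apply: measurable_funM => //; apply: measurable_sum => i.
  by apply: measurable_sum => i'; apply: measurable_funB; exact: mb.
apply: measurable_fun_ifT; first exact: measurable_unitmx.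
  apply: measurable_mulmx => // i j; apply: measurable_mulmx => [{}i {}j|{}i {}j].
    by under eq_fun do rewrite mxE; exact: mU.
  exact: measurable_invmx.
exact: measurable_funPT.
Qed.

HB.instance Definition _ n :=
  isMeasurableFun.Build _ _ _ _ (test_stat n) (measurable_test_stat n).

Definition test_stat_rv (n : nat) : {RV P >-> R} := test_stat n.

End random_sample.

(* Main.v *)
Require Import Defs.
From HB Require Import structures.
From mathcomp Require Import all_boot all_order all_algebra finmap.
From mathcomp Require Import all_classical all_reals all_analysis.
From mathcomp Require Import measurable_realfun zify ring lra.

Set Implicit Arguments.
Unset Strict Implicit.
Unset Printing Implicit Defensive.

Import Order.TTheory GRing.Theory Num.Theory.
Import numFieldNormedType.Exports.
Local Open Scope classical_set_scope.
Local Open Scope ring_scope.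

(** The statistic compares the two blocks of observations through the signs of
    [X_j - X_i]. Write [g] for the vector of centered grades [2 F_k - 1]; it is
    bounded, centered (continuity of the marginals excludes ties), and its
    second moment matrix is [Sigma].

    - Projection. The mean of the comparison kernel given one of its two
      arguments is plus or minus the grade, so that removing
      [g_k (X_j) - g_k (X_i)] leaves a kernel that is degenerate in both
      arguments. The remainders of distinct pairs are orthogonal
      ([Ex_resid_orthogonal]), and the change-point vector is at distance
      [O(n^(-1/2))] in L2 from [S = sum_j a_j g(X_j)]
      ([Ex_sqr_projection_error]). The weights [a_j] have squares of order
      [1/n] that sum to [1].

    - Estimation. The same orthogonality argument, applied to the empirical
      distribution functions and to the products of grades, shows that the
      empirical matrix is at distance [O(n^(-1/2))] in L1 from [Sigma]
      ([Ex_norm_hatSigma_error]). By continuity of the inverse, the statistic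
      is therefore close in probability to [q(S)], where [q] is the quadratic
      form of the inverse of [Sigma] ([test_stat_close]).

    - Central limit theorem. The limit of the law of [q(S)] is found through its
      Laplace transform, with neither Gaussian vectors nor characteristic
      functions. The kernels [l^(K/2) exp (- l q(x))], with
      [1/l = 1/s + 2 (1 - t)], solve the backward heat equation in [t]. Along
      the partial sums, with [t] the sum of the squares of the weights already
      used, the mean of the kernel hence changes by [O(|a_j|^3)] at each step
      ([step_bound], [Ex_increment]). From [t = 0] to [t = 1] this gives
      [E exp (- s q(S)) -> (1 + 2 s)^(-K/2)] ([laplace_clt]), which is the
      Laplace transform of the chi-square law ([laplace_chi_square]).

    - Conclusion. The functions [1 - (1 - exp (- m z))^N] are polynomials in
      [exp (- z)] and approximate the indicators of half-lines
      ([step_testP]), so that Laplace transforms control distribution functions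
      ([cvg_cdf_chi_square]); the error in probability is absorbed by shifting
      the half-line. *)

(** * Bounded random variables and their expectation *)

Section bounded_measurable.
Context d (T : measurableType d) (R : realType).
Implicit Types f g : T -> R.

(** All the random variables at hand are bounded, so that this predicate
    settles every integrability condition. *)
Definition bmfun f :=
  measurable_fun [set: T] f /\ exists M, forall x, `|f x| <= M.

Lemma bmfun_cst (c : R) : bmfun (fun=> c).
Proof. by split; [exact: measurable_cst|exists `|c|]. Qed.

Lemma bmfunD f g : bmfun f -> bmfun g -> bmfun (fun x => f x + g x).
Proof.
move=> [mf [M fM]] [mg [N gN]]; split; first exact: measurable_funD.
by exists (M + N) => x; rewrite (le_trans (ler_normD _ _))// lerD.
Qed.

Lemma bmfunM f g : bmfun f -> bmfun g -> bmfun (fun x => f x * g x).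
Proof.
move=> [mf [M fM]] [mg [N gN]]; split; first exact: measurable_funM.
by exists (M * N) => x; rewrite normrM ler_pM.
Qed.

Lemma bmfunZ (c : R) f : bmfun f -> bmfun (fun x => c * f x).
Proof. by move=> ?; apply: bmfunM => //; exact: bmfun_cst. Qed.

Lemma bmfunN f : bmfun f -> bmfun (fun x => - f x).
Proof.
move=> [mf [M fM]]; split; last by exists M => x; rewrite normrN.
exact: measurableT_comp.
Qed.

Lemma bmfunB f g : bmfun f -> bmfun g -> bmfun (fun x => f x - g x).
Proof. by move=> bf bg; apply: bmfunD => //; exact: bmfunN. Qed.

Lemma bmfunX n f : bmfun f -> bmfun (fun x => f x ^+ n).
Proof.
move=> [mf [M fM]]; split; first exact: measurable_funX.
exists (M ^+ n) => x; have M0 : 0 <= M by exact: le_trans (fM x).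
by rewrite normrX; apply: lerXn2r; rewrite ?nnegrE.
Qed.

Lemma bmfun_norm f : bmfun f -> bmfun (fun x => `|f x|).
Proof.
move=> [mf [M fM]]; split; first exact: measurableT_comp.
by exists M => x; rewrite normr_id.
Qed.

Lemma bmfun_sum (I : Type) (s : seq I) (Q : pred I) (F : I -> T -> R) :
  (forall i, Q i -> bmfun (F i)) -> bmfun (fun x => \sum_(i <- s | Q i) F i x).
Proof.
move=> bF; elim: s => [|i s IH].
  by under eq_fun do rewrite big_nil; exact: bmfun_cst.
case Qi: (Q i); under eq_fun do rewrite big_cons Qi; last exact: IH.
by apply: bmfunD => //; exact: bF.
Qed.

Lemma bmfun_bool (b : T -> bool) :
  measurable_fun [set: T] b -> bmfun (fun x => (b x)%:R).
Proof.
move=> mb; split; last by exists 1 => x; case: (b x); rewrite ?normr1 ?normr0.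
by under eq_fun do rewrite mulrb; exact: measurable_fun_ifT.
Qed.

Lemma bmfun_expR f :
  bmfun f -> bmfun (fun x => expR (f x)).
Proof.
move=> [mf [M fM]]; split; first exact: measurableT_comp.
exists (expR M) => x; rewrite ger0_norm ?expR_ge0// ler_expR.
exact: le_trans (ler_norm _) (fM x).
Qed.

End bounded_measurable.

Lemma bmfun_comp d d' (T : measurableType d) (T' : measurableType d')
    (R : realType) (f : T' -> R) (g : T -> T') :
  bmfun f -> measurable_fun [set: T] g -> bmfun (fun x => f (g x)).
Proof.
move=> [mf [M fM]] mg; split; first exact: measurableT_comp.
by exists M => x; exact: fM.
Qed.

Section expectation_of_bounded.
Context d (T : measurableType d) (R : realType) (P : probability T R).
Implicit Types f g : T -> R.

Definition Ex f : R := \int[P]_x f x.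

Lemma bmfun_integrable f : bmfun f -> P.-integrable [set: T] (EFin \o f).
Proof.
move=> [mf [M fM]]; apply: measurable_bounded_integrable => //.
  by rewrite /= probability_setT ltry.
exists M; split; first exact: num_real.
by move=> x Mx y _ /=; rewrite (le_trans (fM y))// ltW.
Qed.

Lemma Ex_fineK f : bmfun f -> (\int[P]_x (f x)%:E = (Ex f)%:E)%E.
Proof.
by move=> /bmfun_integrable bf; rewrite /Ex fineK//; exact: integrable_fin_num.
Qed.

Lemma ExD f g : bmfun f -> bmfun g -> Ex (fun x => f x + g x) = Ex f + Ex g.
Proof. by move=> bf bg; rewrite /Ex RintegralD//; exact: bmfun_integrable. Qed.

Lemma ExB f g : bmfun f -> bmfun g -> Ex (fun x => f x - g x) = Ex f - Ex g.
Proof. by move=> bf bg; rewrite /Ex RintegralB//; exact: bmfun_integrable. Qed.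

Lemma ExZ (c : R) f : bmfun f -> Ex (fun x => c * f x) = c * Ex f.
Proof. by move=> bf; rewrite /Ex RintegralZl//; exact: bmfun_integrable. Qed.

Lemma Ex_cst (c : R) : Ex (fun=> c) = c.
Proof. by rewrite /Ex Rintegral_cst//= probability_setT /= mulr1. Qed.

Lemma Ex_sum (I : Type) (s : seq I) (Q : pred I) (F : I -> T -> R) :
  (forall i, Q i -> bmfun (F i)) ->
  Ex (fun x => \sum_(i <- s | Q i) F i x) = \sum_(i <- s | Q i) Ex (F i).
Proof.
move=> bF; elim: s => [|i s IH].
  by under [LHS]eq_Rintegral do rewrite big_nil; rewrite -/(Ex _) Ex_cst big_nil.
rewrite big_cons -IH; case: ifPn => Qi.
  rewrite -ExD//; [|exact: bF|exact: bmfun_sum].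
  by congr Ex; apply/funext => x; rewrite big_cons Qi.
by congr Ex; apply/funext => x; rewrite big_cons (negbTE Qi).
Qed.

Lemma Ex_le f g : bmfun f -> bmfun g -> (forall x, f x <= g x) -> Ex f <= Ex g.
Proof. by move=> bf bg fg; apply: le_Rintegral => //; exact: bmfun_integrable. Qed.

Lemma Ex_ge0 f : (forall x, 0 <= f x) -> 0 <= Ex f.
Proof. by move=> f0; apply: Rintegral_ge0. Qed.

Lemma Ex_norm f : bmfun f -> `|Ex f| <= Ex (fun x => `|f x|).
Proof. by move=> bf; apply: le_normr_Rintegral => //; exact: bmfun_integrable. Qed.

Lemma Ex_norm_le f (M : R) : bmfun f -> (forall x, `|f x| <= M) -> `|Ex f| <= M.
Proof.
move=> bf fM; rewrite (le_trans (Ex_norm bf))//.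
rewrite -[leRHS]Ex_cst; apply: Ex_le => //; [exact: bmfun_norm|exact: bmfun_cst].
Qed.

Lemma Ex_bool (b : T -> bool) : measurable_fun [set: T] b ->
  P [set x | b x] = (Ex (fun x => (b x)%:R))%:E.
Proof.
move=> mb; rewrite -Ex_fineK; last exact: bmfun_bool.
have mB : measurable [set x | b x].
  by rewrite -[X in measurable X]setTI; exact: mb.
transitivity (P ([set x | b x] `&` setT)); first by rewrite setIT.
rewrite -integral_indic//; apply: eq_integral => x _.
by rewrite indicE mem_setE.
Qed.

(** Expanding the square leaves only the diagonal terms. All the variance
    estimates below come from this bound. *)
Lemma Ex_sqr_sum_orthogonal (I : finType) (Z : I -> T -> R) (M : R) :
  (forall i, bmfun (Z i)) -> (forall i x, `|Z i x| <= M) ->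
  (forall i j, i != j -> Ex (fun x => Z i x * Z j x) = 0) ->
  Ex (fun x => (\sum_i Z i x) ^+ 2) <= #|I|%:R * M ^+ 2.
Proof.
move=> bZ ZM ort.
have -> : (fun x => (\sum_i Z i x) ^+ 2) =
    (fun x => \sum_i \sum_j Z i x * Z j x).
  by apply/funext => x; rewrite expr2 big_distrlr.
have bb i j : bmfun (fun x => Z i x * Z j x) by exact: bmfunM.
rewrite Ex_sum; last by move=> i _; exact: bmfun_sum.
rewrite mulr_natl -sumr_const; apply: ler_sum => i _.
rewrite Ex_sum// (bigD1 i)//= big1 ?addr0; last first.
  by move=> j ji; rewrite ort// eq_sym.
rewrite (le_trans (ler_norm _))// Ex_norm_le// => x.
have M0 : 0 <= M by exact: le_trans (ZM i x).
by rewrite -expr2 normrX; apply: lerXn2r; rewrite ?nnegrE.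
Qed.

End expectation_of_bounded.

(** The variance of [`|Z|] is nonnegative. *)
Lemma Ex_norm_sqr d (T : measurableType d) (R : realType)
    (P : probability T R) (Z : T -> R) :
  bmfun Z -> Ex P (fun w => `|Z w|) ^+ 2 <= Ex P (fun w => Z w ^+ 2).
Proof.
move=> bZ; have bN := bmfun_norm bZ; set c := Ex P (fun w => `|Z w|).
have : 0 <= Ex P (fun w => (`|Z w| - c) ^+ 2) by apply: Ex_ge0 => w; exact: sqr_ge0.
have -> : (fun w => (`|Z w| - c) ^+ 2) =
    fun w => Z w ^+ 2 - (2 * c * `|Z w| - c ^+ 2).
  apply/funext => w; rewrite -[Z w ^+ 2]real_normK ?num_real//; ring.
rewrite ExB; [|exact: bmfunX|]; last first.
  by apply: bmfunB; [exact: bmfunZ|exact: bmfun_cst].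
rewrite ExB; [|exact: bmfunZ|exact: bmfun_cst].
by rewrite ExZ// Ex_cst -/c; nra.
Qed.

(** * Independence *)

Lemma Ex_distribution d d' (T : measurableType d) (T' : measurableType d')
    (R : realType) (P : probability T R) (Y : {RV P >-> T'}) (f : T' -> R) :
  bmfun f -> Ex (distribution P Y) f = Ex P (f \o Y).
Proof.
move=> bf; have [mf _] := bf; rewrite /Ex /Rintegral.
rewrite integral_distribution//; first exact/measurable_EFinP.
by apply: bmfun_integrable; apply: bmfun_comp.
Qed.

Section independence.
Context d d' (T : measurableType d) (E : measurableType d') (R : realType).
Variables (P : probability T R) (X : nat -> {RV P >-> E}).
Hypothesis iidX : iid X.

Lemma Ex_iid (i : nat) (f : E -> R) :
  bmfun f -> Ex P (fun w => f (X i w)) = Ex P (fun w => f (X 0%N w)).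
Proof.
move=> bf; have [_ idX] := iidX.
rewrite -[LHS](Ex_distribution (X i) bf) -[RHS](Ex_distribution (X 0) bf).
by rewrite /Ex /Rintegral; congr fine; apply: eq_measure_integral => A mA _;
  exact: idX.
Qed.

Section freezing.
Variables (N : nat) (i : 'I_N) (e0 : E).

Definition sample (w : T) : N.-tuple E := [tuple X j w | j < N].

(** Position [i] of the sample is overwritten by a constant, so that the
    remaining observations form a variable independent of [X i]. *)
Definition others (w : T) : N.-tuple E :=
  [tuple if j == i then e0 else X j w | j < N].

Lemma measurable_sample : measurable_fun [set: T] sample.
Proof.
apply/measurable_fun_tnthP => j.
rewrite (_ : _ \o _ = X j); first exact: measurable_funPT.
by apply/funext => w /=; rewrite tnth_mktuple.
Qed.

Lemma bmfun_sample (f : N.-tuple E -> R) :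
  bmfun f -> bmfun (fun w => f (sample w)).
Proof. by move=> /bmfun_comp; apply; exact: measurable_sample. Qed.

Lemma bmfun_sample_pair (f : N.-tuple E * E -> R) (j : nat) :
  bmfun f -> bmfun (fun w => f (sample w, X j w)).
Proof.
move=> /bmfun_comp; apply; apply: measurable_fun_pair.
  exact: measurable_sample.
exact: measurable_funPT.
Qed.

Lemma measurable_others : measurable_fun [set: T] others.
Proof.
apply/measurable_fun_tnthP => j.
rewrite (_ : _ \o _ = if j == i then cst e0 else X j).
  by case: ifP => _; [exact: measurable_cst|exact: measurable_funPT].
by apply/funext => w /=; rewrite tnth_mktuple; case: ifP.
Qed.

HB.instance Definition _ :=
  isMeasurableFun.Build _ _ _ _ others measurable_others.

(** For rectangles, independence is the product rule for the finite family
    obtained by adding [i] to the indices other than [i]. The constant [e0]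
    either satisfies its constraint or makes the event empty. *)
Lemma others_indep_rectangle (a : 'I_N -> set E) (B : set E) :
  (forall j, measurable (a j)) -> measurable B ->
  P (others @^-1` [set t | forall j, a j (tnth t j)] `&` X i @^-1` B) =
  (P (others @^-1` [set t | forall j, a j (tnth t j)]) * P (X i @^-1` B))%E.
Proof.
move=> ma mB; have [indX _] := iidX.
have [ae0|nae0] := pselect (a i e0); last first.
  have -> : others @^-1` [set t | forall j, a j (tnth t j)] = set0.
    rewrite -subset0 => w /= /(_ i); rewrite tnth_mktuple eqxx.
    exact: nae0.
  by rewrite set0I measure0 mul0e.
pose J := [fset k in iota 0 N | k != i]%fset.
have JE k : (k \in J) = (k < N)%N && (k != i).
  by rewrite !inE /= mem_iota add0n leq0n.
pose A k : set E := if k == i :> nat then B else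
  if insub k is Some j then a j else setT.
have mA k : measurable (A k).
  rewrite /A; case: ifP => // _; case: insubP => [j _ _|_]; first exact: ma.
  exact: measurableT.
have oE : others @^-1` [set t | forall j, a j (tnth t j)] =
    \bigcap_(k in [set` J]) (X k @^-1` A k).
  apply/seteqP; split => w /=.
    move=> aw k /=; rewrite JE => /andP[kN ki].
    rewrite /A (negbTE ki) insubT /=.
    by have := aw (Ordinal kN); rewrite tnth_mktuple -val_eqE /= (negbTE ki).
  move=> aw j; rewrite tnth_mktuple; case: eqVneq => [->//|ji].
  have := aw (val j); rewrite /= JE ltn_ord val_eqE ji => /(_ isT).
  by rewrite /A val_eqE (negbTE ji) valK.
rewrite oE indX//.
have -> : \bigcap_(k in [set` J]) (X k @^-1` A k) `&` X i @^-1` B =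
    \bigcap_(k in [set` (val i |` J)%fset]) (X k @^-1` A k).
  apply/seteqP; split => w /=.
    by move=> [wJ wB] k /=; rewrite in_fset1U => /predU1P[->|/wJ//]; rewrite /A eqxx.
  move=> wJ; split=> [k kJ|]; first by apply: wJ; rewrite /= in_fset1U kJ orbT.
  by have := wJ (val i); rewrite /A eqxx; apply; rewrite /= in_fset1U eqxx.
rewrite indX// big_fsetU1/= ?JE ?eqxx ?andbF//.
by rewrite muleC {2}/A eqxx.
Qed.

Lemma setI_closed_rectangles :
  setI_closed [set A : set (N.-tuple E) | exists2 a : 'I_N -> set E,
    (forall j, measurable (a j)) & A = [set t | forall j, a j (tnth t j)]].
Proof.
move=> _ _ [a ma ->] [b mb ->]; exists (fun j => a j `&` b j).
  by move=> j; exact: measurableI.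
apply/seteqP; split => t /=; first by move=> [ta tb] j; split.
by move=> tab; split => j; case: (tab j).
Qed.

Lemma measurable_tuple_rectangles :
  @measurable _ (N.-tuple E) =
  <<s [set A : set (N.-tuple E) | exists2 a : 'I_N -> set E,
    (forall j, measurable (a j)) & A = [set t | forall j, a j (tnth t j)]] >>.
Proof.
apply/seteqP; split; last first.
  apply: smallest_sub; first exact: sigma_algebra_measurable.
  move=> _ [a ma ->].
  rewrite (_ : [set t | _] =
      \bigcap_(j in [set: 'I_N]) ((@tnth _ E ^~ j) @^-1` a j)); last first.
    by apply/seteqP; split => t /= ta j; [move=> _|]; exact: ta.
  apply: fin_bigcap_measurable => // j _.
  by rewrite -[X in measurable X]setTI; exact: measurable_tnth.
apply: smallest_sub; first exact: smallest_sigma_algebra.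
rewrite -bigcup_seq => A [j _ [B mB <-]]; apply: sub_gen_smallest.
exists (fun k => if k == j then B else setT).
  by move=> k; case: ifP => // _; exact: measurableT.
rewrite setTI; apply/seteqP; split => t /=; last first.
  by move=> /(_ j); rewrite eqxx.
by move=> tB k; case: eqVneq => [->|].
Qed.

(** Rectangles are stable under intersection and generate the product
    sigma-algebra; the events satisfying the product rule form a Dynkin system. *)
Lemma others_indep (A : set (N.-tuple E)) (B : set E) :
  measurable A -> measurable B ->
  P (others @^-1` A `&` X i @^-1` B) =
  (P (others @^-1` A) * P (X i @^-1` B))%E.
Proof.
move=> mA mB; move: (mA); rewrite measurable_tuple_rectangles; move: A {mA}.
have mo A : measurable A -> measurable (others @^-1` A).
  by move=> mA; rewrite -[X in measurable X]setTI; exact: measurable_others.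
have mi : measurable (X i @^-1` B).
  by rewrite -[X in measurable X]setTI; exact: measurable_funPT.
apply: (dynkin_induction measurable_tuple_rectangles).
- exact: setI_closed_rectangles.
- by rewrite preimage_setT setTI probability_setT mul1e.
- by move=> _ [a ma ->]; exact: others_indep_rectangle.
- move=> S mS IS; have -> : others @^-1` (~` S) = ~` (others @^-1` S) by [].
  rewrite setIC -setDE measureD//; [|exact: mo|].
  + transitivity (P (X i @^-1` B) - P (others @^-1` S `&` X i @^-1` B))%E.
      by congr (_ - P _)%E; rewrite setIC.
    rewrite IS probability_setC; last exact: mo.
    by rewrite muleBl ?mul1e// fin_num_measure.
  + by rewrite (le_lt_trans (probability_le1 _ _)) ?ltry.
- move=> F mF tF IF.
  have tF' : trivIset setT (fun k => others @^-1` F k).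
    move/trivIsetP : tF => tF; apply/trivIsetP => k l _ _ kl.
    rewrite (_ : _ `&` _ = others @^-1` (F k `&` F l))//.
    by rewrite tF// preimage_set0.
  rewrite preimage_bigcup setI_bigcupl measure_bigcup//; last 2 first.
  + by move=> k _; apply: measurableI => //; exact: mo.
  + move/trivIsetP : tF' => tF'; apply/trivIsetP => k l _ _ kl.
    by rewrite setIACA tF'// set0I.
  rewrite measure_bigcup//; last by move=> k _; exact: mo.
  rewrite muleC -[P (X i @^-1` B)]fineK ?fin_num_measure// -nneseriesZl//.
  apply: eq_eseriesr => k _.
  by rewrite fineK ?fin_num_measure// muleC; exact: IF.
Qed.

(** The joint law is the product of the marginal laws, so this is Fubini. *)
Lemma Ex_freeze (h : N.-tuple E * E -> R) : bmfun h ->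
  Ex P (fun w => h (others w, X i w)) =
  Ex P (fun w => Ex P (fun w' => h (others w, X 0%N w'))).
Proof.
move=> bh; have [mh [M hM]] := bh.
pose Z := fun w => (others w, X i w).
have mZ : measurable_fun [set: T] Z.
  by apply: measurable_fun_pair => //; exact: measurable_funPT.
pose ZM := isMeasurableFun.Build _ _ _ _ Z mZ.
pose ZR : {RV P >-> (N.-tuple E * E)%type} := HB.pack Z ZM.
rewrite -[LHS](Ex_distribution ZR bh).
pose PZ := (distribution P others \x distribution P (X i))%E.
have bhx t : bmfun (fun x => h (t, x)).
  split; last by exists M.
  by apply: measurableT_comp => //; exact: pair1_measurable.
have -> : Ex (distribution P ZR) h =
    fine (\int[PZ]_z (h z)%:E)%E.
  congr fine; apply: eq_measure_integral => /= A mA _.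
  apply/esym/product_measure_unique => // A1 A2 mA1 mA2.
  exact: others_indep.
pose g t := Ex P (fun w => h (t, X 0%N w)).
have gE t : (\int[distribution P (X i)]_y (h (t, y))%:E = (g t)%:E)%E.
  rewrite Ex_fineK//; congr EFin.
  by rewrite Ex_distribution//; exact: Ex_iid (bhx t).
have ih : PZ.-integrable [set: _] (EFin \o h).
  exact: (@bmfun_integrable _ _ _ (product_prob (distribution P others)
                                       (distribution P (X i)))).
have bg : bmfun g.
  split.
    apply/measurable_EFinP; rewrite [_ \o _](_ : _ =
        fubini_F (distribution P (X i)) (EFin \o h)).
      exact: measurable_fubini_F ih.
    by apply/funext => t; rewrite /fubini_F gE.
  exists M => t; apply: Ex_norm_le => //; apply: bmfun_comp (bhx t) _.
  exact: measurable_funPT.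
rewrite -(integral12_prod_meas1 ih) /=.
under eq_integral do rewrite /fubini_F /= gE.
exact: (Ex_distribution others bg).
Qed.

(** A function of the sample and of [X i] that has mean zero in its last
    argument when the other observations are fixed has mean zero. *)
Lemma Ex_centered0 (h : N.-tuple E -> E -> R) :
  bmfun (fun z => h z.1 z.2) ->
  (forall t t' x, (forall j, j != i -> tnth t j = tnth t' j) ->
    h t x = h t' x) ->
  (forall t, Ex P (fun w => h t (X 0%N w)) = 0) ->
  Ex P (fun w => h (sample w) (X i w)) = 0.
Proof.
move=> bh hi h0.
rewrite (_ : (fun w => _) = fun w => h (others w) (X i w)); last first.
  apply/funext => w; apply: hi => j ji.
  by rewrite !tnth_mktuple (negbTE ji).
rewrite (Ex_freeze bh) /=.
under [LHS]eq_Rintegral do rewrite h0.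
exact: Ex_cst.
Qed.

End freezing.
End independence.

(** * Third-order estimates for a Gaussian kernel *)

Section scalar_estimates.
Variable R : realType.
Implicit Types x y z a : R.

(** Compare the tail of the exponential series, shifted by three terms, with
    the exponential series of [`|y|]. *)
Lemma expR_taylor2 y :
  `|expR y - (1 + y + y ^+ 2 / 2)| <= `|y| ^+ 3 * expR `|y|.
Proof.
have cS x : series (exp_coeff x) n @[n --> \oo] --> expR x.
  exact: is_cvg_series_exp_coeff.
pose u n := `|series (exp_coeff y) (n + 3)%N - (1 + y + y ^+ 2 / 2)|.
pose v n := `|y| ^+ 3 * series (exp_coeff `|y|) n.
have cu : u n @[n --> \oo] --> `|expR y - (1 + y + y ^+ 2 / 2)|.
  apply: cvg_norm; apply: cvgB; last exact: cvg_cst.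
  by rewrite (cvg_shiftn 3 (series (exp_coeff y))); exact: cS.
have cv : v n @[n --> \oo] --> `|y| ^+ 3 * expR `|y|.
  by apply: cvgM; [exact: cvg_cst|exact: cS].
rewrite -(cvg_lim _ cu)// -(cvg_lim _ cv)//.
apply: ler_lim; [exact: cvgP cu|exact: cvgP cv|].
apply: nearW => n; rewrite /u /v /series /=.
rewrite addn3 !big_nat_recl//= /exp_coeff /=.
rewrite expr0 expr1 fact0 !factS fact0 !muln1 !divr1.
set S := \sum_(0 <= i < n) _.
rewrite (_ : _ - _ = S); last by ring.
rewrite /S (le_trans (ler_norm_sum _ _ _))// mulr_sumr.
apply: ler_sum => i _; rewrite normrM normrX mulrA -exprD.
rewrite ler_wpM2l ?exprn_ge0// normfV ger0_norm// lef_pV2 ?posrE ?ltr0n ?fact_gt0//.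
by rewrite ler_nat; apply: leq_fact; do 3 apply: leqW.
Qed.

Lemma ln1D_bounds z : 0 <= z -> [/\ 0 <= ln (1 + z), ln (1 + z) <= z &
  z - ln (1 + z) <= z ^+ 2].
Proof.
move=> z0; have z1 : 0 < 1 + z by lra.
split; first by rewrite ln_ge0// lerDl.
  by apply: le_ln1Dx; lra.
have : ln (1 - z / (1 + z)) <= - (z / (1 + z)).
  apply: le_ln1Dx; rewrite ltrN2 ltr_pdivrMr//; lra.
have -> : 1 - z / (1 + z) = (1 + z)^-1 by field; rewrite gt_eqF.
rewrite lnV ?posrE// lerN2 => h.
have : z - z ^+ 2 <= z / (1 + z) by rewrite ler_pdivlMr//; nra.
lra.
Qed.

(** [1 + x] is at most [1 + 3 / lo] times [1 + lo x / 3], which is at most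
    [expR (lo x / 3)]. *)
Lemma cubic_expRN_bound (lo x : R) : 0 < lo -> 0 <= x ->
  (1 + x) ^+ 3 * expR (- (lo * x)) <= (1 + 3 / lo) ^+ 3.
Proof.
move=> lo0 x0; rewrite expRN ler_pdivrMr ?expR_gt0//.
have -> : lo * x = (lo * x / 3) * 3%:R by field.
rewrite expRM_natr -exprMn; apply: lerXn2r; rewrite ?nnegrE; first lra.
  by rewrite mulr_ge0 ?expR_ge0// addr_ge0// divr_ge0// ltW.
have h : 1 + lo * x / 3 <= expR (lo * x / 3) by exact: expR_ge1Dx.
have c0 : 0 < 3 / lo by rewrite divr_gt0.
have : (1 + 3 / lo) * (1 + lo * x / 3) <= (1 + 3 / lo) * expR (lo * x / 3).
  by rewrite ler_wpM2l//; lra.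
apply: le_trans.
have -> : (1 + 3 / lo) * (1 + lo * x / 3) = 1 + x + (3 / lo + lo * x / 3).
  by field; rewrite gt_eqF.
by rewrite lerDl addr_ge0 ?(ltW c0)// divr_ge0 ?mulr_ge0 // ltW.
Qed.

Lemma normrBB_le (p q r p' q' r' : R) : 0 <= p -> 0 <= q -> 0 <= r ->
  p <= p' -> q <= q' -> r <= r' -> `|p - q - r| <= p' + q' + r'.
Proof. by move=> *; rewrite ler_norml; apply/andP; split; lra. Qed.

(** One step of the central limit theorem, reduced to real numbers: [X], [b] and
    [w] stand for [q(x)], the polar form at [(x, y)], and [q(y)], where [y] is
    the new observation and [x] the current partial sum. The relation between
    [l] and [l'] is that their inverses differ by [2 a^2]. The logarithm of the
    ratio of the two kernels is [Y1 + Y2] with [Y1] of order [a] and [Y2] of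
    order [a^2]; the cubic remainder grows polynomially in [X], which the factor
    [exp (- l X)] compensates. The bounds by [B] hold because the weights are
    of order [n^(-1/2)] and the observations bounded; they keep the exponent
    bounded. *)
Lemma step_bound (K : nat) (s lo Q B : R) :
  0 < lo -> 0 < s -> 0 <= Q -> 0 <= B -> exists2 C : R, 0 <= C &
  forall a l l' X b w : R, lo <= l -> l <= l' -> l' <= s -> `|a| <= 1 ->
    l' = l + 2 * a ^+ 2 * l * l' ->
    0 <= X -> 0 <= w <= Q -> b ^+ 2 <= X * w -> `|a * b| <= B ->
    a ^+ 2 * X <= B ->
    `|expR (K%:R / 2 * ln l' - l' * (X + 2 * a * b + a ^+ 2 * w)) -
      expR (K%:R / 2 * ln l - l * X) *
      (1 + (- 2 * l' * a * b + 2 * l' ^+ 2 * a ^+ 2 * b ^+ 2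
            - l' * a ^+ 2 * w + l' * a ^+ 2 * K%:R
            - 2 * l' ^+ 2 * a ^+ 2 * X))| <= C * `|a| ^+ 3.
Proof.
move=> lo0 s0 Q0 B0.
pose c1 := 2 * s * (1 + Q); pose c2 := K%:R * s + 2 * s ^+ 2 + s * Q.
pose M0 := 2 * s * B + K%:R * s + 2 * s ^+ 2 * B + s * Q.
pose C1 := (c1 + c2) ^+ 3 * expR M0 + 2 * K%:R * s ^+ 2 + 4 * s ^+ 3 +
  c1 * c2 + c2 ^+ 2.
pose C2 := expR (K%:R / 2 * ln s) * (1 + 3 / lo) ^+ 3.
have k0 : 0 <= K%:R :> R by [].
have c10 : 0 <= c1 by rewrite /c1; nra.
have c20 : 0 <= c2 by rewrite /c2; nra.
have C10 : 0 <= C1.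
  have s00 := ltW s0; have c12 : 0 <= c1 + c2 by exact: addr_ge0.
  by rewrite /C1 !addr_ge0// ?exprn_ge0// ?mulr_ge0 ?exprn_ge0 ?expR_ge0// addr_ge0.
have C20 : 0 <= C2.
  by rewrite mulr_ge0 ?expR_ge0// exprn_ge0// addr_ge0// divr_ge0// ltW.
exists (C1 * C2); first exact: mulr_ge0.
move=> a l l' X b w lol ll' l's a1 l'E X0 /andP[w0 wQ] bXw abB aXB.
have l0 : 0 < l by lra.
have l'0 : 0 < l' by lra.
have s00 := ltW s0; have l00 := ltW l0; have l'00 := ltW l'0.
pose z := 2 * a ^+ 2 * l'.
have a20 : 0 <= a ^+ 2 by exact: sqr_ge0.
have z0 : 0 <= z by rewrite /z; nra.
(* Up to [z ^+ 2], the logarithm [e] of [l' / l] is [z], and [K / 2 * z] is the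
   compensator of [l' * a ^+ 2 * w]. *)
have ratioE : l' = l * (1 + z) by rewrite /z {1}l'E; ring.
have lnE : ln l' = ln l + ln (1 + z).
  by rewrite {1}ratioE lnM// posrE; lra.
have [e0 ez ez2] := ln1D_bounds z0.
set e := ln (1 + z) in lnE e0 ez ez2.
pose Y1 := - 2 * l' * a * b.
pose Y2 := K%:R / 2 * e - z * l * X - l' * a ^+ 2 * w.
pose D := K%:R / 2 * (e - z) + z ^+ 2 * l * X + Y1 * Y2 + Y2 ^+ 2 / 2.
pose Y := Y1 + Y2.
set F := expR (K%:R / 2 * ln l - l * X).
have -> : expR (K%:R / 2 * ln l' - l' * (X + 2 * a * b + a ^+ 2 * w)) =
    F * expR Y.
  rewrite -expRD lnE; congr expR; rewrite /Y /Y1 /Y2.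
  have -> : l' * (X + 2 * a * b + a ^+ 2 * w) =
    l' * X + 2 * l' * a * b + l' * a ^+ 2 * w by ring.
  by rewrite [in l' * X]ratioE; ring.
rewrite -mulrBr normrM.
set M := (X in 1 + X).
have -> : expR Y - (1 + M) = (expR Y - (1 + Y + Y ^+ 2 / 2)) + D.
  have ME : M = Y1 + Y1 ^+ 2 / 2 - l' * a ^+ 2 * w + K%:R / 2 * z - z * l' * X.
    by rewrite /M /Y1 /z; field.
  have E1 : z ^+ 2 * l * X = z * l' * X - z * l * X.
    by rewrite [in z * l' * X]ratioE; ring.
  by rewrite ME /D E1 /Y /Y2; field.
clearbody M.
set A := `|a|; have A0 : 0 <= A by exact: normr_ge0.
have a2E : a ^+ 2 = A ^+ 2 by rewrite /A real_normK// num_real.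
set L := 1 + X; have L1 : 1 <= L by rewrite /L lerDl.
have XL : X <= L by rewrite /L lerDr.
have A21 : A ^+ 2 <= A by rewrite expr2 ler_piMl.
have L0 : 0 <= L by exact: le_trans L1.
have bL : `|b| <= (1 + Q) * L.
  have b2 : `|b| ^+ 2 <= X * Q.
    by rewrite real_normK ?num_real// (le_trans bXw)// ler_wpM2l.
  have b0 := normr_ge0 b; rewrite /L; move: (`|b|) b0 b2 Q0 X0 => t.
  by clear; nra.
have Y1E : `|Y1| = 2 * l' * (A * `|b|).
  by rewrite /Y1 !normrM normrN (ger0_norm l'00) normr_nat -!mulrA.
have HY1 : `|Y1| <= c1 * A * L.
  have -> : c1 * A * L = 2 * s * (A * ((1 + Q) * L)) by rewrite /c1; ring.
  rewrite Y1E; apply: ler_pM; [exact: mulr_ge0|exact: mulr_ge0| |].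
    by rewrite ler_wpM2l.
  exact: ler_wpM2l.
have ls : l <= s by exact: le_trans l's.
have zs : z <= 2 * s * A ^+ 2.
  by rewrite /z a2E mulrAC ler_wpM2r ?exprn_ge0// ler_wpM2l.
have ke0 : 0 <= K%:R / 2 * e by rewrite mulr_ge0// divr_ge0.
have zlX0 := mulr_ge0 (mulr_ge0 z0 l00) X0.
have law0 := mulr_ge0 (mulr_ge0 l'00 a20) w0.
have A20 : 0 <= A ^+ 2 by exact: exprn_ge0.
have HY2 : `|Y2| <= c2 * A ^+ 2 * L.
  have h1 : K%:R / 2 * e <= K%:R * s * A ^+ 2 * L.
    have -> : K%:R * s * A ^+ 2 * L = K%:R / 2 * (2 * s * A ^+ 2 * L) by field.
    apply: ler_wpM2l; first exact: divr_ge0.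
    rewrite (le_trans ez)// (le_trans zs)// ler_peMr// mulr_ge0//.
    exact: mulr_ge0.
  have h2 : z * l * X <= 2 * s ^+ 2 * A ^+ 2 * L.
    have -> : 2 * s ^+ 2 * A ^+ 2 * L = 2 * s * A ^+ 2 * s * L by ring.
    by apply: ler_pM => //; [exact: mulr_ge0|exact: ler_pM].
  have h3 : l' * a ^+ 2 * w <= s * Q * A ^+ 2 * L.
    apply: (@le_trans _ _ (s * Q * A ^+ 2)); last first.
      by rewrite ler_peMr// !mulr_ge0.
    by rewrite a2E mulrAC ler_wpM2r//; apply: ler_pM.
  have -> : c2 * A ^+ 2 * L = K%:R * s * A ^+ 2 * L + 2 * s ^+ 2 * A ^+ 2 * L +
    s * Q * A ^+ 2 * L by rewrite /c2; ring.
  exact: (normrBB_le ke0 zlX0 law0 h1 h2 h3).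
(* The exponent must be bounded for the Taylor remainder to be cubic; here the
   hypotheses on [B] replace the bounds in terms of [L]. *)
have HYM : `|Y| <= M0.
  have g1 : `|Y1| <= 2 * s * B.
    by rewrite Y1E -normrM; apply: ler_pM; rewrite ?mulr_ge0// ler_wpM2l.
  have a21 : a ^+ 2 <= 1 by rewrite a2E; apply: le_trans A21 a1.
  have h1 : K%:R / 2 * e <= K%:R * s.
    have -> : K%:R * s = K%:R / 2 * (2 * s) by field.
    apply: ler_wpM2l; first exact: divr_ge0.
    by rewrite (le_trans ez)// (le_trans zs)// ler_piMr ?mulr_ge0// -a2E.
  have h2 : z * l * X <= 2 * s ^+ 2 * B.
    have -> : z * l * X = 2 * (l' * l) * (a ^+ 2 * X) by rewrite /z; ring.
    apply: ler_pM => //; [by rewrite !mulr_ge0|exact: mulr_ge0|].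
    by rewrite ler_wpM2l// expr2; apply: ler_pM.
  have h3 : l' * a ^+ 2 * w <= s * Q.
    by apply: ler_pM => //; [rewrite mulr_ge0|rewrite (le_trans _ l's)// ler_piMr].
  rewrite (le_trans (ler_normD _ _))// /M0 -!addrA lerD// addrA.
  exact: (normrBB_le ke0 zlX0 law0 h1 h2 h3).

have AL0 : 0 <= A * L by exact: mulr_ge0.
have A32 : A ^+ 4 <= A ^+ 3 by rewrite (exprS A 3) ler_piMl// exprn_ge0.
have AL3 m : (m <= 3)%N -> A ^+ 3 * L ^+ m <= A ^+ 3 * L ^+ 3.
  by move=> m3; rewrite ler_wpM2l ?exprn_ge0// ler_weXn2l.
have AL4 m : (m <= 3)%N -> A ^+ 4 * L ^+ m <= A ^+ 3 * L ^+ 3.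
  by move=> m3; apply: le_trans (AL3 _ m3); rewrite ler_wpM2r ?exprn_ge0.
have HYA : `|Y| <= (c1 + c2) * (A * L).
  rewrite (le_trans (ler_normD _ _))// mulrDl lerD// ?mulrA//.
  apply: (le_trans HY2); rewrite ler_wpM2r// ler_wpM2l//.
have R1 : `|expR Y - (1 + Y + Y ^+ 2 / 2)| <=
    (c1 + c2) ^+ 3 * expR M0 * (A ^+ 3 * L ^+ 3).
  apply: (le_trans (expR_taylor2 Y)).
  have -> : (c1 + c2) ^+ 3 * expR M0 * (A ^+ 3 * L ^+ 3) =
    ((c1 + c2) * (A * L)) ^+ 3 * expR M0 by ring.
  apply: ler_pM; rewrite ?exprn_ge0 ?expR_ge0 ?ler_expR//.
  by apply: lerXn2r => //; rewrite nnegrE// mulr_ge0// addr_ge0.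
have z24 : z ^+ 2 <= 4 * s ^+ 2 * A ^+ 4.
  have -> : 4 * s ^+ 2 * A ^+ 4 = (2 * s * A ^+ 2) ^+ 2 by ring.
  by apply: lerXn2r; rewrite ?nnegrE// !mulr_ge0// ?exprn_ge0//.
have D1 : `|K%:R / 2 * (e - z)| <= 2 * K%:R * s ^+ 2 * (A ^+ 3 * L ^+ 3).
  rewrite normrM ger0_norm ?mulr_ge0// distrC ger0_norm ?subr_ge0//.
  apply: (@le_trans _ _ (K%:R / 2 * (4 * s ^+ 2 * A ^+ 4))).
    by apply: ler_wpM2l; [rewrite mulr_ge0|apply: le_trans ez2 z24].
  have -> : K%:R / 2 * (4 * s ^+ 2 * A ^+ 4) =
     2 * K%:R * s ^+ 2 * (A ^+ 4 * L ^+ 0) by field.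
  by rewrite ler_wpM2l ?AL4// !mulr_ge0//.
have D2 : `|z ^+ 2 * l * X| <= 4 * s ^+ 3 * (A ^+ 3 * L ^+ 3).
  have z20 : 0 <= z ^+ 2 by exact: sqr_ge0.
  rewrite ger0_norm; last by rewrite mulr_ge0 ?(mulr_ge0 z20).
  apply: (@le_trans _ _ (4 * s ^+ 2 * A ^+ 4 * s * L)).
    apply: ler_pM => //; first by rewrite (mulr_ge0 z20).
    exact: ler_pM.
  have -> : 4 * s ^+ 2 * A ^+ 4 * s * L = 4 * s ^+ 3 * (A ^+ 4 * L ^+ 1) by ring.
  by rewrite ler_wpM2l ?AL4// mulr_ge0// exprn_ge0.
have D3 : `|Y1 * Y2| <= c1 * c2 * (A ^+ 3 * L ^+ 3).
  rewrite normrM; apply: (@le_trans _ _ (c1 * A * L * (c2 * A ^+ 2 * L))).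
    exact: ler_pM.
  have -> : c1 * A * L * (c2 * A ^+ 2 * L) = c1 * c2 * (A ^+ 3 * L ^+ 2) by ring.
  by rewrite ler_wpM2l ?AL3// mulr_ge0.
have D4 : `|Y2 ^+ 2 / 2| <= c2 ^+ 2 * (A ^+ 3 * L ^+ 3).
  rewrite ger0_norm ?divr_ge0 ?sqr_ge0//.
  have : Y2 ^+ 2 / 2 <= Y2 ^+ 2.
    by rewrite ler_pdivrMr// ler_peMr ?sqr_ge0// ler1n.
  move=> /le_trans; apply.
  have -> : Y2 ^+ 2 = `|Y2| ^+ 2 by rewrite real_normK// num_real.
  apply: (@le_trans _ _ ((c2 * A ^+ 2 * L) ^+ 2)).
    by apply: lerXn2r; rewrite ?nnegrE// !mulr_ge0// exprn_ge0.
  have -> : (c2 * A ^+ 2 * L) ^+ 2 = c2 ^+ 2 * (A ^+ 4 * L ^+ 2) by ring.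
  by rewrite ler_wpM2l ?AL4// sqr_ge0.
have R2 : `|(expR Y - (1 + Y + Y ^+ 2 / 2)) + D| <= C1 * (A ^+ 3 * L ^+ 3).
  set t := A ^+ 3 * L ^+ 3.
  have -> : C1 * t = (c1 + c2) ^+ 3 * expR M0 * t + (2 * K%:R * s ^+ 2 * t +
     4 * s ^+ 3 * t + c1 * c2 * t + c2 ^+ 2 * t) by rewrite /C1; ring.
  rewrite (le_trans (ler_normD _ _))// lerD// /D.
  do 3 (rewrite (le_trans (ler_normD _ _))// lerD//).
have FE : F <= expR (K%:R / 2 * ln s) * expR (- (lo * X)).
  rewrite -expRD ler_expR lerD//.
    rewrite ler_wpM2l// ?mulr_ge0// ler_ln ?posrE//; lra.
  by rewrite lerN2 ler_wpM2r.
rewrite ger0_norm ?expR_ge0//.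
apply: (@le_trans _ _ ((expR (K%:R / 2 * ln s) * expR (- (lo * X))) *
    (C1 * (A ^+ 3 * L ^+ 3)))).
  by apply: ler_pM; rewrite ?expR_ge0.
have -> : expR (K%:R / 2 * ln s) * expR (- (lo * X)) * (C1 * (A ^+ 3 * L ^+ 3)) =
  C1 * (expR (K%:R / 2 * ln s) * (L ^+ 3 * expR (- (lo * X)))) * A ^+ 3 by ring.
rewrite ler_wpM2r ?exprn_ge0// ler_wpM2l// ler_wpM2l ?expR_ge0//.
exact: cubic_expRN_bound.
Qed.

End scalar_estimates.

(** * Quadratic forms *)

Section bilinear_form.
Variables (R : realType) (K : nat) (A : 'M[R]_K).
Implicit Types x y z : 'cV[R]_K.

Definition bform x y : R := (x^T *m A *m y) 0 0.

Lemma bformE x y : bform x y = \sum_k \sum_l x k 0 * A k l * y l 0.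
Proof.
rewrite /bform -mulmxA mxE; apply: eq_bigr => k _; rewrite !mxE mulr_sumr.
by apply: eq_bigr => l _; rewrite mulrA.
Qed.

Lemma bformDl x y z : bform (x + y) z = bform x z + bform y z.
Proof. by rewrite /bform linearD !mulmxDl mxE. Qed.

Lemma bformDr x y z : bform z (x + y) = bform z x + bform z y.
Proof. by rewrite /bform mulmxDr mxE. Qed.

Lemma bformZl c x y : bform (c *: x) y = c * bform x y.
Proof. by rewrite /bform linearZ/= -!scalemxAl mxE. Qed.

Lemma bformZr c x y : bform x (c *: y) = c * bform x y.
Proof. by rewrite /bform -scalemxAr mxE. Qed.

Definition entry_norm : R := \sum_k \sum_l `|A k l|.

Lemma entry_norm_ge0 : 0 <= entry_norm.
Proof. by do 2 apply: sumr_ge0 => ? _. Qed.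

Lemma bform_bound x y (p q : R) : 0 <= p -> 0 <= q ->
  (forall k, `|x k 0| <= p) -> (forall k, `|y k 0| <= q) ->
  `|bform x y| <= p * q * entry_norm.
Proof.
move=> p0 q0 xp yq; rewrite bformE (le_trans (ler_norm_sum _ _ _))//.
rewrite mulr_sumr; apply: ler_sum => k _.
rewrite (le_trans (ler_norm_sum _ _ _))// mulr_sumr; apply: ler_sum => l _.
by rewrite !normrM mulrAC ler_wpM2r// ler_pM.
Qed.

Hypothesis symA : A^T = A.
Hypothesis psdA : forall x, 0 <= bform x x.

Lemma bformC x y : bform x y = bform y x.
Proof.
transitivity ((x^T *m A *m y)^T 0 0); first by rewrite mxE.
by rewrite /bform !trmx_mul trmxK symA mulmxA.
Qed.

(** The nonnegative polynomial [t |-> bform (x + t y) (x + t y)] is evaluated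
    at its minimum, or far enough when it is affine. *)
Lemma bform_cauchy_schwarz x y : bform x y ^+ 2 <= bform x x * bform y y.
Proof.
have H t : 0 <= bform x x + 2 * t * bform x y + t ^+ 2 * bform y y.
  have := psdA (x + t *: y).
  rewrite !bformDl !bformDr !bformZl !bformZr (bformC y x).
  by congr (0 <= _); ring.
have [y0|y0] := eqVneq (bform y y) 0.
  have [->|b0] := eqVneq (bform x y) 0; first by rewrite y0 mulr0 expr0n.
  have := H (- (bform x x + 1) / (2 * bform x y)); rewrite y0 mulr0 addr0.
  rewrite (_ : 2 * _ * _ = - (bform x x + 1)); first lra.
  by field.
have yp : 0 < bform y y by rewrite lt_neqAle eq_sym y0 psdA.
have := H (- bform x y / bform y y).
rewrite (_ : _ + _ = (bform x x * bform y y - bform x y ^+ 2) / bform y y).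
  by rewrite pmulr_lge0 ?invr_gt0// subr_ge0.
by field.
Qed.

End bilinear_form.

(** * A central limit theorem for quadratic forms *)

Lemma mul_le_of_sqr (R : realFieldType) (p q r : R) :
  p ^+ 2 <= r -> q ^+ 2 <= r -> p * q <= r.
Proof. by have := sqr_ge0 (p - q); nra. Qed.

Section lindeberg.
Context d d' (T : measurableType d) (E : measurableType d') (R : realType).
Variables (P : probability T R) (X : nat -> {RV P >-> E}).
Hypothesis iidX : iid X.
Variables (e0 : E) (K : nat) (v : 'I_K -> E -> R) (Sg A : 'M[R]_K).
Hypothesis mv : forall k, measurable_fun [set: E] (v k).
Hypothesis v1 : forall k x, `|v k x| <= 1.
Hypothesis Ev : forall k, Ex P (fun w => v k (X 0%N w)) = 0.
Hypothesis Evv : forall k l,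
  Ex P (fun w => v k (X 0%N w) * v l (X 0%N w)) = Sg k l.
Hypothesis symA : A^T = A.
Hypothesis psdA : forall x, 0 <= bform A x x.
Hypothesis ASg : A *m Sg = 1%:M.

Local Notation b := (bform A).
Local Notation Q := (entry_norm A).

Definition vec (x : E) : 'cV[R]_K := \col_k v k x.

Lemma bmfun_v k : bmfun (v k).
Proof. by split=> //; exists 1. Qed.

Lemma bmfun_vX k i : bmfun (fun w => v k (X i w)).
Proof. by apply: bmfun_comp (bmfun_v k) _; exact: measurable_funPT. Qed.

Lemma bmfun_bvecX i x : bmfun (fun w => b x (vec (X i w))).
Proof.
under eq_fun do rewrite bformE; do 2 apply: bmfun_sum => ? _.
by under eq_fun do rewrite mxE; apply: bmfunZ; exact: bmfun_vX.
Qed.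

Lemma bmfun_bvecvecX i : bmfun (fun w => b (vec (X i w)) (vec (X i w))).
Proof.
under eq_fun do rewrite bformE; apply: bmfun_sum => k _; apply: bmfun_sum => l _.
under eq_fun do rewrite !mxE; apply: bmfunM; last exact: bmfun_vX.
by apply: bmfunM; [exact: bmfun_vX|exact: bmfun_cst].
Qed.

Lemma Ex_bvec x : Ex P (fun w => b x (vec (X 0%N w))) = 0.
Proof.
transitivity (Ex P (fun w => \sum_k (x^T *m A) 0 k * v k (X 0%N w))).
  congr Ex; apply/funext => w; rewrite /bform mxE.
  by apply: eq_bigr => k _; rewrite [vec _ _ _]mxE.
rewrite Ex_sum; last by move=> k _; apply: bmfunZ; exact: bmfun_vX.
rewrite big1// => k _; rewrite ExZ ?Ev ?mulr0//; exact: bmfun_vX.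
Qed.

(** The matrix [A] is the inverse of the covariance matrix [Sg], whence
    [x' A Sg A x = x' A x]. *)
Lemma Ex_bvec_sqr x : Ex P (fun w => b x (vec (X 0%N w)) ^+ 2) = b x x.
Proof.
have bvv k l : bmfun (fun w => v k (X 0%N w) * v l (X 0%N w)).
  by apply: bmfunM; exact: bmfun_vX.
transitivity (Ex P (fun w => \sum_k \sum_l
    ((x^T *m A) 0 k * (x^T *m A) 0 l) * (v k (X 0%N w) * v l (X 0%N w)))).
  congr Ex; apply/funext => w; rewrite /bform mxE expr2 big_distrlr /=.
  apply: eq_bigr => k _; apply: eq_bigr => l _.
  by rewrite ![vec _ _ _]mxE; ring.
rewrite Ex_sum; last by move=> k _; apply: bmfun_sum => l _; exact: bmfunZ.
have -> : b x x = bform Sg (x^T *m A)^T (x^T *m A)^T.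
  rewrite /bform trmxK -[x^T *m A *m Sg]mulmxA ASg mulmx1 trmx_mul trmxK symA.
  by rewrite mulmxA.
rewrite bformE; apply: eq_bigr => k _.
rewrite Ex_sum; last by move=> l _; exact: bmfunZ.
by apply: eq_bigr => l _; rewrite ExZ// Evv [_^T k 0]mxE [_^T l 0]mxE; ring.
Qed.

Lemma Ex_bvecvec : Ex P (fun w => b (vec (X 0%N w)) (vec (X 0%N w))) = K%:R.
Proof.
have bvv k l : bmfun (fun w => v k (X 0%N w) * v l (X 0%N w)).
  by apply: bmfunM; exact: bmfun_vX.
transitivity (Ex P (fun w => \sum_k \sum_l
    A k l * (v l (X 0%N w) * v k (X 0%N w)))).
  congr Ex; apply/funext => w; rewrite bformE.
  by apply: eq_bigr => k _; apply: eq_bigr => l _; rewrite !mxE; ring.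
rewrite Ex_sum; last by move=> k _; apply: bmfun_sum => l _; exact: bmfunZ.
transitivity (\tr (A *m Sg)); last by rewrite ASg mxtrace1.
apply: eq_bigr => k _; rewrite mxE Ex_sum; last by move=> l _; exact: bmfunZ.
by apply: eq_bigr => l _; rewrite ExZ// Evv.
Qed.

Section triangular_row.
Variables (N : nat) (a : nat -> R).

Definition psum (t : N.-tuple E) (i : nat) : 'cV[R]_K :=
  \sum_(j < N | (j < i)%N) a j *: vec (tnth t j).

Lemma psum0 t : psum t 0 = 0.
Proof. by rewrite /psum big_pred0. Qed.

Lemma psumS t (i : 'I_N) : psum t i.+1 = psum t i + a i *: vec (tnth t i).
Proof.
rewrite /psum (bigD1 i)/= ?ltnSn// addrC; congr (_ + _).
by apply: eq_bigl => j; rewrite ltnS andbC -val_eqE /= -ltn_neqAle.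
Qed.

Lemma psum_local (i : 'I_N) t t' :
  (forall j, j != i -> tnth t j = tnth t' j) -> psum t i = psum t' i.
Proof.
move=> tt'; apply: eq_bigr => j ji; rewrite tt'//.
by rewrite -val_eqE /= ltn_eqF.
Qed.

Lemma psum_sample w :
  psum (sample X N w) N = \sum_(0 <= j < N) a j *: vec (X j w).
Proof.
rewrite big_mkord; apply: eq_big => j; first by rewrite ltn_ord.
by rewrite tnth_mktuple.
Qed.

Lemma bmfun_psum k i : bmfun (fun t => psum t i k 0).
Proof.
under eq_fun do rewrite summxE; apply: bmfun_sum => j _.
under eq_fun do rewrite !mxE; apply: bmfunZ.
by apply: bmfun_comp (bmfun_v k) _; exact: measurable_tnth.
Qed.

Lemma bmfun_qpsum i : bmfun (fun t => b (psum t i) (psum t i)).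
Proof.
under eq_fun do rewrite bformE; do 2 apply: bmfun_sum => ? _.
apply: bmfunM; last exact: bmfun_psum.
by apply: bmfunM; [exact: bmfun_psum|exact: bmfun_cst].
Qed.

Lemma bmfun_bpsum i :
  bmfun (fun z : N.-tuple E * E => b (psum z.1 i) (vec z.2)).
Proof.
under eq_fun do rewrite bformE; apply: bmfun_sum => k _; apply: bmfun_sum => l _.
apply: bmfunM; last first.
  by under eq_fun do rewrite mxE; apply: bmfun_comp (bmfun_v l) _.
apply: bmfunM; last exact: bmfun_cst.
by apply: bmfun_comp (bmfun_psum k i) _.
Qed.

Lemma bmfun_bvecvec : bmfun (fun z : N.-tuple E * E => b (vec z.2) (vec z.2)).
Proof.
under eq_fun do rewrite bformE; apply: bmfun_sum => k _; apply: bmfun_sum => l _.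
under eq_fun do rewrite !mxE.
apply: bmfunM; last by apply: bmfun_comp (bmfun_v l) _.
apply: bmfunM; last exact: bmfun_cst.
by apply: bmfun_comp (bmfun_v k) _.
Qed.

(** When an observation weighted by [ai] is added to the partial sum [x] while
    the parameter of the kernel increases to [l'], the kernel is multiplied, to
    second order, by [1 + increment l' ai x y]. *)
Definition increment (l' : R) (ai : R) (x y : 'cV[R]_K) : R :=
  - 2 * l' * ai * b x y + 2 * l' ^+ 2 * ai ^+ 2 * b x y ^+ 2
  - l' * ai ^+ 2 * b y y + l' * ai ^+ 2 * K%:R
  - 2 * l' ^+ 2 * ai ^+ 2 * b x x.

(** The mean over the new observation vanishes: this is the heat equation for
    the kernel, the covariance of the observations being the inverse of [A]. *)
Lemma Ex_increment l' ai x :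
  Ex P (fun w => increment l' ai x (vec (X 0%N w))) = 0.
Proof.
have B1 := bmfun_bvecX 0 x; have B2 := bmfunX 2 B1.
have B3 := bmfun_bvecvecX 0.
rewrite /increment.
rewrite ExB; [|do ?apply: bmfunB; do ?[apply: bmfunD|apply: bmfunN];
  do ?apply: bmfunZ => //; exact: bmfun_cst|exact: bmfun_cst].
rewrite ExD; [|do ?apply: bmfunB; do ?[apply: bmfunD|apply: bmfunN];
  do ?apply: bmfunZ => //; exact: bmfun_cst|exact: bmfun_cst].
rewrite ExB; [|apply: bmfunD; exact: bmfunZ|exact: bmfunZ].
rewrite ExD; [|exact: bmfunZ|exact: bmfunZ].
by rewrite !Ex_cst !ExZ// Ex_bvec Ex_bvec_sqr Ex_bvecvec; ring.
Qed.

Lemma bmfun_increment l' ai i :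
  bmfun (fun z : N.-tuple E * E => increment l' ai (psum z.1 i) (vec z.2)).
Proof.
have B1 := bmfun_bpsum i; have B2 := bmfunX 2 B1; have B3 := bmfun_bvecvec.
have B4 : bmfun (fun z : N.-tuple E * E => b (psum z.1 i) (psum z.1 i)).
  by apply: bmfun_comp (bmfun_qpsum i) _.
apply: bmfunB; last exact: bmfunZ.
apply: bmfunD; last exact: bmfun_cst.
apply: bmfunB; last exact: bmfunZ.
by apply: bmfunD; exact: bmfunZ.
Qed.

(** The power [l `^ (K / 2)] is written with a logarithm, so that ratios of
    kernels are exponentials of differences. *)
Definition gauss_kernel (l : R) (x : 'cV[R]_K) : R :=
  expR (K%:R / 2 * ln l - l * b x x).

Lemma bmfun_gauss_kernel l i : bmfun (fun t => gauss_kernel l (psum t i)).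
Proof.
apply: bmfun_expR; apply: bmfunB; first exact: bmfun_cst.
by apply: bmfunZ; exact: bmfun_qpsum.
Qed.

(** The partial sum up to [i] does not involve the observation [i], over which
    the increment has mean zero. *)
Lemma Ex_gauss_kernel_increment l l' (i : 'I_N) :
  Ex P (fun w => gauss_kernel l (psum (sample X N w) i) *
    increment l' (a i) (psum (sample X N w) i) (vec (X i w))) = 0.
Proof.
apply: (Ex_centered0 iidX (i := i) e0 (h := fun t x =>
    gauss_kernel l (psum t i) * increment l' (a i) (psum t i) (vec x))).
- apply: bmfunM; last exact: bmfun_increment.
  by apply: bmfun_comp (bmfun_gauss_kernel l i) _.
- by move=> t t' x tt'; rewrite (psum_local tt').
- move=> t; rewrite ExZ ?Ex_increment ?mulr0//.
  rewrite /increment; apply: bmfunB; last exact: bmfun_cst.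
  apply: bmfunD; last exact: bmfun_cst.
  apply: bmfunB; last by apply: bmfunZ; exact: bmfun_bvecvecX.
  apply: bmfunD; apply: bmfunZ; first exact: bmfun_bvecX.
  by apply: bmfunX; exact: bmfun_bvecX.
Qed.

End triangular_row.

Lemma vec_le1 x k : `|vec x k 0| <= 1.
Proof. by rewrite mxE. Qed.

Lemma bvec_bound x y : `|b (vec x) (vec y)| <= Q.
Proof.
by rewrite -[Q]mul1r -[1 in leRHS]mul1r; apply: bform_bound => // k; exact: vec_le1.
Qed.

Lemma bpsum_bound (N : nat) (a : nat -> R) (C0 : R) (i : 'I_N)
    (t : N.-tuple E) (x : E) :
  (forall j, (j < N)%N -> a j ^+ 2 <= C0 / N%:R) ->
  `|a i * b (psum a t i) (vec x)| <= C0 * Q /\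
  a i ^+ 2 * b (psum a t i) (psum a t i) <= C0 ^+ 2 * Q.
Proof.
move=> aC.
have N0 : (0 < N)%N by case: N i t aC => // -[].
have C00 : 0 <= C0 / N%:R by apply: le_trans (aC i _); rewrite ?sqr_ge0.
have aa (j : 'I_N) : `|a i| * `|a j| <= C0 / N%:R.
  by apply: mul_le_of_sqr; rewrite real_normK ?num_real ?aC.
have pE k : `|(a i *: psum a t i) k 0| <= C0.
  rewrite mxE summxE mulr_sumr (le_trans (ler_norm_sum _ _ _))//.
  apply: (@le_trans _ _ (\sum_(j < N) C0 / N%:R)).
    rewrite big_mkcond /=; apply: ler_sum => j _; case: ifP => // _.
    rewrite mxE !normrM mulrA; apply: le_trans (aa j).
    by rewrite ler_piMr ?mulr_ge0// vec_le1.
  rewrite sumr_const card_ord -[leLHS]mulr_natr divfK// pnatr_eq0; lia.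
have C0p : 0 <= C0.
  by move: C00; rewrite pmulr_lge0// invr_gt0 ltr0n.
split.
  rewrite -bformZl -[C0]mulr1; apply: bform_bound => // k; exact: vec_le1.
rewrite expr2 -mulrA -bformZr -bformZl (le_trans (ler_norm _))// expr2.
exact: bform_bound.
Qed.

(** A quantitative Lindeberg argument. With [l i] the inverse of
    [1 / s + 2 (1 - sg i)] and [sg i] the sum of the first [i] squared weights,
    the mean of the kernel at [(l i, psum i)] moves by at most [C |a_i|^3] at
    step [i]; the squares of the weights sum to one, so the total is of the
    order of the largest weight. At [i = 0] the kernel is evaluated at the
    origin and gives the chi-square transform, at [i = N] it gives the transform
    of the quadratic form. *)
Lemma laplace_clt (s C0 : R) : 0 < s -> 0 <= C0 ->
  exists2 C : R, 0 <= C & forall (N : nat) (a : nat -> R), (0 < N)%N ->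
    \sum_(0 <= j < N) a j ^+ 2 = 1 ->
    (forall j, (j < N)%N -> a j ^+ 2 <= C0 / N%:R) ->
    `|Ex P (fun w => let S := \sum_(0 <= j < N) a j *: vec (X j w) in
        expR (- (s * b S S))) - expR (- (K%:R / 2 * ln (1 + 2 * s)))|
      <= C * Num.sqrt (N%:R^-1).
Proof.
move=> s0 C00; have Q0 := entry_norm_ge0 A.
have s12 : 0 < 1 + 2 * s by lra.
pose lo := s / (1 + 2 * s); have lo0 : 0 < lo by rewrite divr_gt0.
pose B := C0 * Q + C0 ^+ 2 * Q.
have CQ0 : 0 <= C0 * Q by exact: mulr_ge0.
have CCQ0 : 0 <= C0 ^+ 2 * Q by rewrite mulr_ge0 ?sqr_ge0.
have B0 : 0 <= B by exact: addr_ge0.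
have [C C_ge0 HC] := step_bound K lo0 s0 Q0 B0.
pose c := expR (K%:R / 2 * ln s); have c0 : 0 < c by exact: expR_gt0.
exists (c^-1 * (C * Num.sqrt C0)).
  by rewrite mulr_ge0 ?invr_ge0 ?(ltW c0)// mulr_ge0 ?sqrtr_ge0.
move=> N a N0 a1 aC.
pose sg i := \sum_(0 <= j < i) a j ^+ 2.
have sg0 i : 0 <= sg i by apply: sumr_ge0 => j _; exact: sqr_ge0.
have sg1 i : (i <= N)%N -> sg i <= 1.
  move=> iN; rewrite -a1 (big_cat_nat _ iN)//= lerDl.
  by apply: sumr_ge0 => j _; exact: sqr_ge0.
have sgS i : sg i.+1 = sg i + a i ^+ 2 by rewrite /sg big_nat_recr.
pose den i := s^-1 + 2 * (1 - sg i).
have si0 : 0 < s^-1 by rewrite invr_gt0.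
have den_ge i : (i <= N)%N -> s^-1 <= den i.
  by move=> /sg1 h; rewrite lerDl mulr_ge0// subr_ge0.
have den0 i : (i <= N)%N -> 0 < den i by move=> /den_ge; exact: lt_le_trans.
pose l i := (den i)^-1.
have l_le_s i : (i <= N)%N -> l i <= s.
  by move=> iN; rewrite -[leRHS]invrK lef_pV2 ?posrE ?den0 ?den_ge.
have lo_le_l i : (i <= N)%N -> lo <= l i.
  move=> iN; have -> : lo = (s^-1 + 2)^-1.
    by rewrite /lo; field; rewrite !gt_eqF//; lra.
  rewrite lef_pV2 ?posrE ?den0// ?addr_gt0// lerD2l ler_piMr// gerBl.
  exact: sg0.
pose Phi i := Ex P (fun w => gauss_kernel (l i) (psum a (sample X N w) i)).
have bk l' i : bmfun (fun w => gauss_kernel l' (psum a (sample X N w) i)).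
  exact: (bmfun_sample X (@bmfun_gauss_kernel N a l' i)).
have step (i : 'I_N) : `|Phi i.+1 - Phi i| <= C * `|a i| ^+ 3.
  have iN := ltn_ord i; have iN' := ltnW iN.
  rewrite /Phi -[X in `|X|]subr0 -(Ex_gauss_kernel_increment a (l i) (l i.+1) i).
  have bi : bmfun (fun w => gauss_kernel (l i) (psum a (sample X N w) i) *
      increment (l i.+1) (a i) (psum a (sample X N w) i) (vec (X i w))).
    apply: bmfunM => //.
    exact: (bmfun_sample_pair X i (@bmfun_increment N a (l i.+1) (a i) i)).
  rewrite -ExB// -ExB//; last exact: bmfunB.
  apply: Ex_norm_le; first by do ?apply: bmfunB.
  move=> w; rewrite psumS tnth_mktuple.
  set x := psum a _ i; set y := vec (X i w).
  rewrite /increment /gauss_kernel !bformDl !bformDr !bformZl !bformZr.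
  rewrite (bformC symA y x).
  have -> : b x x + a i * b x y + (a i * b x y + a i * (a i * b y y)) =
    b x x + 2 * a i * b x y + a i ^+ 2 * b y y by ring.
  rewrite -addrA -opprD -[X in _ - (X + _)]mulr1 -mulrDr.
  have [h1 h2] := bpsum_bound i (sample X N w) (X i w) aC.
  have ll' : l i <= l i.+1.
    rewrite lef_pV2 ?posrE ?den0// lerD2l ler_wpM2l// lerD2l lerN2 sgS lerDl.
    exact: sqr_ge0.
  apply: HC => //.
  - exact: lo_le_l.
  - exact: l_le_s.
  - rewrite -(@ler_pXn2r _ 2)// ?nnegrE// real_normK ?num_real// expr1n.
    rewrite -a1.
    by rewrite big_mkord (bigD1 i)//= lerDl sumr_ge0// => j _; exact: sqr_ge0.
  - have d1 := den0 _ iN; have d2 := den0 _ iN'.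
    have : den i = den i.+1 + 2 * a i ^+ 2 by rewrite /den sgS; ring.
    rewrite /l; move: (den i) (den i.+1) (a i) d1 d2 => p q r q0 p0 pE.
    rewrite {}pE in p0 *; field.
    by rewrite !gt_eqF.
  - by rewrite psdA /= (le_trans (ler_norm _))// bvec_bound.
  - exact: bform_cauchy_schwarz.
  - by rewrite (le_trans h1)// lerDl.
  - by rewrite (le_trans h2)// lerDr.
have tele : `|Phi N - Phi 0%N| <= C * Num.sqrt (C0 / N%:R).
  rewrite -(telescope_sumr Phi (leq0n N)) (le_trans (ler_norm_sum _ _ _))//.
  have -> : C * Num.sqrt (C0 / N%:R) =
      \sum_(i < N) C * (Num.sqrt (C0 / N%:R) * a i ^+ 2).
    by rewrite -mulr_sumr -mulr_sumr -(big_mkord xpredT (fun i => a i ^+ 2)) a1 mulr1.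
  rewrite big_mkord.
  apply: ler_sum => i _; apply: (le_trans (step i)); rewrite ler_wpM2l//.
  rewrite exprSr mulrC -(real_normK (num_real (a i))) ler_wpM2r ?exprn_ge0//.
  by rewrite -sqrtr_sqr ler_wsqrtr// aC.
have Phi0 : Phi 0%N = c * expR (- (K%:R / 2 * ln (1 + 2 * s))).
  rewrite /Phi; under eq_fun do rewrite psum0.
  rewrite Ex_cst /gauss_kernel /bform mulmx0 mxE mulr0 subr0 -expRD.
  have -> : l 0%N = s / (1 + 2 * s).
    by rewrite /l /den /sg big_nil; field; rewrite !gt_eqF//; lra.
  by rewrite ln_div ?posrE// mulrBr.
have PhiN : Phi N = c * Ex P (fun w =>
    let S := \sum_(0 <= j < N) a j *: vec (X j w) in expR (- (s * b S S))).
  have lN : l N = s by rewrite /l /den /sg a1 subrr mulr0 addr0 invrK.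
  rewrite /Phi lN -ExZ.
    congr Ex; apply/funext => w; rewrite /= -psum_sample /gauss_kernel -expRD.
    by [].
  under eq_fun do rewrite /= -psum_sample.
  apply: bmfun_expR; apply: bmfunN; apply: bmfunZ.
  exact: (bmfun_sample X (@bmfun_qpsum N a N)).
move: tele; rewrite Phi0 PhiN -mulrBr normrM (gtr0_norm c0).
rewrite sqrtrM// => tele.
by rewrite -(mulrA c^-1) ler_pdivlMl// -(mulrA C).
Qed.

End lindeberg.

(** * The Laplace transform of the chi-square distribution *)

Section chi_square_laplace.
Variable R : realType.
Local Notation mu := (@lebesgue_measure R).

(** The density is the Radon-Nikodym derivative of the normal law. *)
Lemma integral_normal_prob (f : R -> R) (m s : R) : bmfun f ->
  (\int[normal_prob m s]_x (f x)%:E =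
   \int[mu]_x ((f x)%:E * (normal_pdf m s x)%:E))%E.
Proof.
move=> bf; have ifn := bmfun_integrable (normal_prob m s) bf.
have dom := normal_prob_dominates m s.
rewrite -(Radon_Nikodym_change_of_variables dom)//=.
apply: ae_eq_integral => //.
- apply: emeasurable_funM => //; first exact: measurable_int ifn.
- apply: emeasurable_funM => //; first exact: measurable_int ifn.
  by apply/measurable_EFinP; exact: measurable_normal_pdf.
- apply: ae_eqe_mul2l => /=.
  rewrite Radon_NikodymE//=.
  case: cid => /= h [h1 h2 h3].
  apply: integral_ae_eq => //=.
  + by apply/measurable_EFinP; exact: measurable_normal_pdf.
  + by move=> A _ mA; rewrite -h3.
Qed.

(** The product of [exp (- s x^2)] with the standard normal density is, up to
    the factor [sg], the normal density of standard deviation [sg]. *)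
Lemma laplace_normal_sqr (s : R) : 0 <= s ->
  (\int[normal_prob (0 : R) 1]_x (expR (- (s * x ^+ 2)))%:E =
   (expR (- (2^-1 * ln (1 + 2 * s))))%:E)%E.
Proof.
move=> s0; have c0 : 0 < 1 + 2 * s by lra.
pose sg := (Num.sqrt (1 + 2 * s))^-1.
have sq0 : 0 < Num.sqrt (1 + 2 * s) by rewrite sqrtr_gt0.
have sg0 : 0 < sg by rewrite invr_gt0.
have sgE : expR (- (2^-1 * ln (1 + 2 * s))) = sg.
  rewrite expRN; congr (_^-1); apply/eqP.
  rewrite -(eqrXn2 (n := 2))// ?expR_ge0 ?ltW// sqr_sqrtr ?ltW//.
  by rewrite -expRM_natr mulrC mulrA mulfV ?mul1r// lnK.
have sg2 : sg ^+ 2 = (1 + 2 * s)^-1.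
  by rewrite /sg exprVn sqr_sqrtr// ltW.
rewrite sgE integral_normal_prob; last first.
  split.
    apply: measurableT_comp => //; apply: measurableT_comp => //.
    by apply: measurable_funM => //; exact: measurable_funX.
  exists 1 => x; rewrite ger0_norm ?expR_ge0// -expR0 ler_expR oppr_le0.
  by rewrite mulr_ge0 ?sqr_ge0.
have E x : ((expR (- (s * x ^+ 2)))%:E * (normal_pdf 0 1 x)%:E =
    sg%:E * (normal_pdf 0 sg x)%:E)%E.
  rewrite -!EFinM; congr EFin; rewrite !normal_pdfE ?oner_neq0 ?gt_eqF//.
  rewrite /normal_fun subr0 sg2 expr1n.
  have -> : normal_peak sg = sg^-1 * normal_peak (1 : R).
    rewrite /normal_peak expr1n mul1r -mulrnAr sqrtrM ?sqr_ge0//.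
    by rewrite sqrtr_sqr gtr0_norm// invfM.
  rewrite -(mulrA sg^-1) (mulrA sg) mulfV ?gt_eqF// mul1r mulrCA -expRD.
  congr (_ * expR _).
  rewrite -[1 *+ 2]mulr_natr -[_^-1 *+ 2]mulr_natr; field.
  by rewrite gt_eqF.
under eq_integral do rewrite E.
rewrite ge0_integralZl//=; last 3 first.
- by apply/measurable_EFinP; exact: measurable_normal_pdf.
- by move=> x _; rewrite lee_fin normal_pdf_ge0.
- by rewrite lee_fin ltW.
by rewrite integral_normal_pdf mule1.
Qed.

Lemma chi_square_lt0 K : chi_square R K `]-oo, (0 : R)[%classic = 0%E.
Proof.
elim: K => [|K IH] /=.
  by rewrite diracE memNset//= in_itv/= ltxx.
apply/eqP; rewrite eq_le measure_ge0 andbT.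
rewrite /distribution /pushforward /product_prob.
set A := `]-oo, (0 : R)[%classic in IH *.
apply: (@le_trans _ _
    ((chi_square R K \x normal_prob (0 : R) 1)%E (A `*` [set: R]))).
  apply: le_measure; rewrite ?inE.
  - rewrite -[X in measurable X]setTI; apply: measurable_add_sqr => //.
    exact: measurable_itv.
  - by apply: measurableX => //; exact: measurable_itv.
  move=> [x y] /=; rewrite /A /= !in_itv/= /add_sqr /= => xy; split=> //.
  by have := sqr_ge0 y; lra.
rewrite product_measure1E//=; last exact: measurable_itv.
by rewrite [X in (X * _)%E](_ : _ = 0%E) ?mul0e.
Qed.

Lemma laplace_chi_square K (s : R) : 0 <= s ->
  (\int[chi_square R K]_x (expR (- (s * x)))%:E =
   (expR (- (K%:R / 2 * ln (1 + 2 * s))))%:E)%E.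
Proof.
move=> s0; elim: K => [|K IH].
  rewrite /= integral_dirac//; last first.
    apply/measurable_EFinP; apply: measurableT_comp => //.
    by apply: measurableT_comp => //; exact: measurable_funM.
  by rewrite diracT mul1e mulr0 !mul0r oppr0.
rewrite /= ge0_integral_distribution; last 2 first.
- apply/measurable_EFinP; apply: measurableT_comp => //.
  by apply: measurableT_comp => //; exact: measurable_funM.
- by move=> y; rewrite lee_fin expR_ge0.
pose f (z : R * R) : R := expR (- (s * (z.1 + z.2 ^+ 2))).
have mf : measurable_fun [set: R * R] f.
  apply: measurableT_comp => //; apply: measurableT_comp => //.
  by apply: measurable_funM => //; exact: measurable_add_sqr.
transitivity (\int[chi_square R K \x normal_prob (0 : R) 1]_z (f z)%:E)%E.
  by [].
rewrite fubini_tonelli1//=; [|exact/measurable_EFinP|]; last first.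
  by move=> z; rewrite lee_fin expR_ge0.
rewrite /fubini_F.
under eq_integral => x _.
  rewrite /f /=.
  under eq_integral do rewrite mulrDr opprD expRD EFinM.
  rewrite ge0_integralZl//=; last first.
    apply/measurable_EFinP; apply: measurableT_comp => //.
    apply: measurableT_comp => //.
    by apply: measurable_funM => //; exact: measurable_funX.
  rewrite laplace_normal_sqr//.
  over.
rewrite ge0_integralZr//=; last first.
  apply/measurable_EFinP; apply: measurableT_comp => //.
  by apply: measurableT_comp => //; exact: measurable_funM.
rewrite IH -EFinM -expRD; congr (expR _)%:E.
by rewrite -[K.+1]addn1 natrD; field.
Qed.

End chi_square_laplace.

(** * From Laplace transforms to distribution functions *)

Section step_test.
Variable R : realType.
Implicit Types (x y z w eta : R) (m N : nat).

Lemma bernoulli_le w N : 0 <= w <= 1 -> 1 - N%:R * w <= (1 - w) ^+ N.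
Proof.
move=> /andP[w0 w1]; elim: N => [|N IH]; first by rewrite mul0r subr0 expr0.
rewrite exprS -natr1; have N0 : 0 <= N%:R :> R by [].
have : (1 - w) * (1 - N%:R * w) <= (1 - w) * (1 - w) ^+ N.
  by rewrite ler_wpM2l// subr_ge0.
by apply: le_trans; nra.
Qed.

(** A smooth approximation of the indicator of [z <= x]. As a polynomial in
    [expR (- z)], its mean is a combination of Laplace transforms; [m] sets the
    slope and [N] the location. The absolute value makes it bounded on the whole
    line without changing it where the statistics live. *)
Definition step_test m N z : R := 1 - (1 - expR (- (m%:R * `|z|))) ^+ N.

Lemma expR_absN01 m z : 0 <= expR (- (m%:R * `|z|)) <= 1.
Proof. by rewrite expR_ge0 -expR0 ler_expR oppr_le0 mulr_ge0. Qed.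

Lemma step_test01 m N z : 0 <= step_test m N z <= 1.
Proof.
have /andP[w0 w1] := expR_absN01 m z.
by rewrite subr_ge0 gerBl exprn_ge0 ?subr_ge0// exprn_ile1 ?subr_ge0// gerBl.
Qed.

Lemma step_testE m N z : step_test m N z =
  1 - \sum_(j < N.+1) (-1) ^+ j * 'C(N, j)%:R * expR (- ((m * j)%:R * `|z|)).
Proof.
rewrite /step_test exprBn; congr (_ - _); apply: eq_bigr => j _.
rewrite expr1n mulr1 -expRM_natr -[LHS]mulr_natr [LHS]mulrAC.
by congr (_ * expR _); rewrite natrM; ring.
Qed.

(** With [N] close to [exp (m (x + y) / 2)], the quantity [N exp (- m z)] is
    exponentially large for [z <= x] and exponentially small for [z >= y]; the
    two bounds are [1 - w <= exp (- w)] and the Bernoulli inequality. A negative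
    [x] can be replaced by [0], unless [y <= 0], where the zero function works. *)
Lemma step_testP x y eta : x < y -> 0 < eta -> exists m N, forall z,
  (`|z| <= x -> 1 - eta <= step_test m N z) /\
  (y <= `|z| -> step_test m N z <= eta).
Proof.
move=> xy e0; have [y0|y0] := leP y 0.
  exists 0%N, 0%N => z; split => [zx|_]; last by rewrite /step_test expr0 subrr ltW.
  by have := normr_ge0 z; lra.
pose x' := Num.max x 0; have xx' : x <= x' by rewrite le_max lexx.
have x'0 : 0 <= x' by rewrite le_max lexx orbT.
have x'y : x' < y by rewrite gt_max xy.
pose de := (y - x') / 2; have de0 : 0 < de by rewrite /de; lra.
pose m := (Num.truncn (2 / eta / de)).+1.
pose N := (Num.truncn (expR (m%:R * ((x' + y) / 2)))).+1.
have m0 : 0 < m%:R :> R by rewrite ltr0n.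
have me : 2 / eta <= expR (m%:R * de).
  apply: le_trans (expR_ge1Dx _).
  have : 2 / eta / de <= m%:R by apply/ltW/truncnS_gt.
  by rewrite ler_pdivrMr//; lra.
have me' : 2 * expR (- (m%:R * de)) <= eta.
  by rewrite expRN ler_pdivrMr ?expR_gt0// mulrC -ler_pdivrMr.
set M := expR (m%:R * ((x' + y) / 2)) in N.
have M1 : 1 <= M by rewrite -expR0 ler_expR mulr_ge0// divr_ge0//; lra.
have MN : M <= N%:R by apply/ltW/truncnS_gt.
have NM : N%:R <= 2 * M.
  have : (Num.truncn M)%:R <= M by rewrite truncn_le//; lra.
  by rewrite /N -natr1; lra.
exists m, N => z; have /andP[w0 w1] := expR_absN01 m z.
set w := expR _ in w0 w1 *.
split => [zx|zy].
  rewrite /step_test -/w lerD2l lerN2.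
  have NR : 0 < N%:R * w by rewrite mulr_gt0 ?expR_gt0// ltr0n.
  apply: (@le_trans _ _ (expR (- (N%:R * w)))).
    rewrite -mulrN mulrC expRM_natr.
    apply: lerXn2r; rewrite ?nnegrE ?subr_ge0 ?expR_ge0//.
    exact: expR_ge1Dx.
  rewrite expRN; apply: (@le_trans _ _ (N%:R * w)^-1).
    rewrite lef_pV2 ?posrE ?expR_gt0//.
    by rewrite (le_trans _ (expR_ge1Dx _))// lerDr.
  apply: le_trans me'; apply: (@le_trans _ _ (expR (- (m%:R * de)))); last first.
    by have := expR_ge0 (- (m%:R * de)); lra.
  rewrite expRN lef_pV2 ?posrE ?expR_gt0//.
  apply: (@le_trans _ _ (M * w)); last by rewrite ler_wpM2r// expR_ge0.
  rewrite /M /w -expRD ler_expR.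
  have -> : m%:R * de = m%:R * ((x' + y) / 2) - m%:R * x' by rewrite /de; field.
  by rewrite lerD2l lerN2 ler_wpM2l// (le_trans zx).
apply: le_trans me'.
have wE : w <= expR (- (m%:R * y)) by rewrite ler_expR lerN2 ler_wpM2l// ltW.
have := @bernoulli_le w N; rewrite w0 w1 => /(_ isT) h.
apply: (@le_trans _ _ (N%:R * w)).
  by rewrite /step_test -/w lerBlDr addrC -lerBlDr.
apply: (@le_trans _ _ (2 * M * expR (- (m%:R * y)))).
  by apply: ler_pM => //; rewrite expR_ge0.
rewrite -mulrA /M -expRD ler_wpM2l// ler_expR.
have -> : m%:R * ((x' + y) / 2) - m%:R * y = - (m%:R * de) by rewrite /de; field.
by [].
Qed.

Lemma measurable_step_test m N : measurable_fun [set: R] (step_test m N).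
Proof.
apply: measurable_funB => //; apply: measurable_funX; apply: measurable_funB => //.
apply: measurableT_comp => //; apply: measurableT_comp => //.
apply: measurable_funM => //; exact: measurableT_comp.
Qed.

Lemma bmfun_step_test m N : bmfun (step_test m N).
Proof.
split; first exact: measurable_step_test.
exists 1 => z; have /andP[h0 h1] := step_test01 m N z.
by rewrite ger0_norm.
Qed.

End step_test.

Lemma indicator_le_above (R : realFieldType) (u z x eps eta p : R) :
  0 <= p -> 0 <= eta -> (z <= x + eps -> 1 - eta <= p) ->
  (u <= x)%R%:R <= p + eta + (eps < `|u - z|)%R%:R.
Proof.
move=> p0 eta0 h; case: (leP u x) => ux; case: (ltP eps) => uz /=; try lra.
by move: uz; rewrite ler_norml => /andP[? ?]; have := h ltac:(lra); lra.
Qed.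

Lemma indicator_ge_below (R : realFieldType) (u z x eps eta p : R) :
  p <= 1 -> 0 <= eta -> (x - eps <= z -> p <= eta) ->
  p <= (u <= x)%R%:R + eta + (eps < `|u - z|)%R%:R.
Proof.
move=> p1 eta0 h; case: (leP u x) => ux; case: (ltP eps) => uz /=; try lra.
by move: uz; rewrite ler_norml => /andP[? ?]; have := h ltac:(lra); lra.
Qed.

Section laplace_criterion.
Context d (T : measurableType d) (R : realType) (P : probability T R).
Variable K : nat.
Local Notation chi := (chi_square R K).
Local Notation L := (fun s : R => expR (- (K%:R / 2 * ln (1 + 2 * s)))).

Lemma bmfun_expRN_abs (s : R) : 0 <= s -> bmfun (fun z : R => expR (- (s * `|z|))).
Proof.
move=> s0; split.
  apply: measurableT_comp => //; apply: measurableT_comp => //.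
  apply: measurable_funM => //; exact: measurableT_comp.
exists 1 => z; rewrite ger0_norm ?expR_ge0// -expR0 ler_expR oppr_le0.
by rewrite mulr_ge0.
Qed.

Lemma Ex_chi_square_laplace (s : R) : 0 <= s ->
  Ex chi (fun z => expR (- (s * `|z|))) = L s.
Proof.
move=> s0; rewrite /Ex /Rintegral -[RHS]/(fine (L s)%:E).
rewrite -laplace_chi_square//; congr fine.
apply: ae_eq_integral => //.
- by apply/measurable_EFinP; have [] := bmfun_expRN_abs s0.
- apply/measurable_EFinP; apply: measurableT_comp => //.
  by apply: measurableT_comp => //; exact: measurable_funM.
exists `]-oo, (0 : R)[%classic; split.
- exact: measurable_itv.
- exact: chi_square_lt0.
move=> z /= zE; rewrite in_itv/= ltNge; apply/negP => z0; apply: zE => _.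
by rewrite ger0_norm.
Qed.

Variables (Z V : nat -> T -> R).
Hypothesis bZ : forall n, bmfun (Z n).
Hypothesis Z0 : forall n w, 0 <= Z n w.
Hypothesis mV : forall n, measurable_fun [set: T] (V n).
Hypothesis lapZ : forall s, 0 < s ->
  Ex P (fun w => expR (- (s * Z n w))) @[n --> \oo] --> L s.
Hypothesis VZ : forall eps eta : R, 0 < eps -> 0 < eta -> \forall n \near \oo,
  Ex P (fun w => (eps < `|V n w - Z n w|)%R%:R) <= eta.

(** Expand the power; the term of index [0] is constant. *)
Lemma cvg_Ex_step_test m N :
  Ex P (fun w => step_test m N (Z n w)) @[n --> \oo] --> Ex chi (step_test m N).
Proof.
have E0 d' (T' : measurableType d') (P' : probability T' R) (Y : T' -> R) :
    measurable_fun [set: T'] Y ->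
    Ex P' (fun w => step_test m N (Y w)) = 1 - \sum_(j < N.+1)
      (-1) ^+ j * 'C(N, j)%:R * Ex P' (fun w => expR (- ((m * j)%:R * `|Y w|))).
  move=> mY; have bj j : bmfun (fun w => expR (- ((m * j)%:R * `|Y w|))).
    by apply: (bmfun_comp (bmfun_expRN_abs _) mY).
  under eq_fun do rewrite step_testE.
  rewrite ExB; [|exact: bmfun_cst|by apply: bmfun_sum => j _; exact: bmfunZ].
  rewrite Ex_cst Ex_sum; last by move=> j _; exact: bmfunZ.
  by congr (_ - _); apply: eq_bigr => j _; rewrite ExZ.
rewrite (E0 _ _ chi id)//.
under eq_fun => n do rewrite (E0 _ _ P (Z n) (proj1 (bZ n))).
apply: cvgB; first exact: cvg_cst.
apply: cvg_big => [|j _]; first exact: add_continuous.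
apply: cvgM; first exact: cvg_cst.
rewrite Ex_chi_square_laplace//.
under eq_fun do under eq_fun do rewrite ger0_norm ?Z0//.
have [->|mj] := eqVneq (m * j)%N 0%N.
  under eq_fun do under eq_fun do rewrite mul0r oppr0 expR0.
  rewrite mulr0 addr0 ln1 mulr0 oppr0 expR0.
  under eq_fun do rewrite Ex_cst.
  exact: cvg_cst.
by apply: lapZ; rewrite ltr0n lt0n.
Qed.

Local Notation F := (fun x : R => fine (chi `]-oo, x]%classic)).

Lemma chi_cdfE x : F x = Ex chi (fun z => (z <= x)%R%:R).
Proof.
have mle : measurable_fun [set: R] (fun z => z <= x).
  exact: measurable_fun_ler.
by rewrite -[RHS]/(fine (Ex chi (fun z => (z <= x)%R%:R))%:E) -Ex_bool.
Qed.

Lemma bmfun_le x : bmfun (fun z : R => (z <= x)%R%:R : R).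
Proof. by apply: bmfun_bool; exact: measurable_fun_ler. Qed.

Lemma chi_neg0 : Ex chi (fun z => (z < 0)%R%:R) = 0.
Proof.
have mlt : measurable_fun [set: R] (fun z : R => z < 0).
  exact: measurable_fun_ltr.
apply: EFin_inj; rewrite -Ex_bool// -[RHS](chi_square_lt0 R K).
by congr (chi _); apply/seteqP; split => z /=; rewrite in_itv.
Qed.

(** The distribution function of [V n] at [x] lies between the means of two
    steps in [Z n], one on each side of [x], up to [eta] and to the probability
    that [V n] and [Z n] differ by more than [eps]. Those means converge; by
    continuity at [x], the limit of the upper one is at most [F x + 2 * eta] and
    that of the lower one at least [F x - 2 * eta]. *)
Lemma cvg_cdf_chi_square x : {for x, continuous F} ->
  Ex P (fun w => (V n w <= x)%R%:R) @[n --> \oo] --> F x.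
Proof.
move=> cF; apply/cvgrPdist_le => eta0 eta00.
pose eta := eta0 / 5; have eta_gt0 : 0 < eta by rewrite divr_gt0.
have [de de0 Hde] : exists2 de, 0 < de & forall y, `|x - y| < de ->
    `|F x - F y| <= eta.
  move/cvgrPdist_le : cF => /(_ _ eta_gt0) [de /= de0 H].
  by exists de => // y xy; apply: H.
pose eps := de / 4; have eps0 : 0 < eps by rewrite divr_gt0.
have [m1 [N1 H1]] := @step_testP R (x + eps) (x + 2 * eps) eta ltac:(lra) eta_gt0.
have [m2 [N2 H2]] := @step_testP R (x - 2 * eps) (x - eps) eta ltac:(lra) eta_gt0.
have bV n y : bmfun (fun w => (V n w <= y)%R%:R : R).
  by apply: (bmfun_comp (bmfun_le y)).
have bS m N n : bmfun (fun w => step_test m N (Z n w)).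
  by apply: (bmfun_comp (bmfun_step_test R m N)); have [] := bZ n.
have bD n : bmfun (fun w => (eps < `|V n w - Z n w|)%R%:R : R).
  apply: bmfun_bool; apply: measurable_fun_ltr => //.
  apply: measurableT_comp => //; apply: measurable_funB => //.
  by have [] := bZ n.
have bc : bmfun (fun _ : T => eta) by exact: bmfun_cst.
have up : Ex chi (step_test m1 N1) <= F x + 2 * eta.
  have : F (x + 2 * eps) <= F x + eta.
    have := Hde (x + 2 * eps); rewrite opprD addNKr normrN gtr0_norm; last lra.
    have -> : 2 * eps < de by rewrite /eps; lra.
    by move=> /(_ isT); rewrite ler_norml => /andP[]; lra.
  suff : Ex chi (step_test m1 N1) <= F (x + 2 * eps) + eta by lra.
  rewrite chi_cdfE -[X in _ + X](Ex_cst chi) -ExD; [|exact: bmfun_le|exact: bmfun_cst].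
  apply: Ex_le; [exact: bmfun_step_test| |move=> z].
    by apply: bmfunD; [exact: bmfun_le|exact: bmfun_cst].
  have [_ h] := H1 z; have /andP[h0 h1] := step_test01 m1 N1 z.
  case: (leP z (x + 2 * eps)) => zx /=; first lra.
  by rewrite add0r h// (le_trans (ltW zx))// ler_norm.
have lo : F x - 2 * eta <= Ex chi (step_test m2 N2).
  have : F x - eta <= F (x - 2 * eps).
    have := Hde (x - 2 * eps); rewrite opprB addrCA subrr addr0 gtr0_norm; last lra.
    have -> : 2 * eps < de by rewrite /eps; lra.
    by move=> /(_ isT); rewrite ler_norml => /andP[]; lra.
  suff : F (x - 2 * eps) - eta <= Ex chi (step_test m2 N2) by lra.
  rewrite lerBlDr chi_cdfE.
  have bn : bmfun (fun z : R => (z < 0)%R%:R : R).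
    by apply: bmfun_bool; exact: measurable_fun_ltr.
  have be : bmfun (fun _ : R => eta) by exact: bmfun_cst.
  have ben := bmfunD be bn; have bs := bmfun_step_test R m2 N2.
  apply: (@le_trans _ _
      (Ex chi (fun z => step_test m2 N2 z + (eta + (z < 0)%R%:R)))); last first.
    by rewrite (ExD chi bs ben) (ExD chi be bn) Ex_cst chi_neg0 addr0.
  apply: Ex_le; [exact: bmfun_le|exact: bmfunD|move=> z].
  have [h _] := H2 z; have /andP[h0 h1] := step_test01 m2 N2 z.
  case: (ltP z 0) => z0 /=; first by case: (z <= _) => /=; lra.
  case: (leP z (x - 2 * eps)) => zx /=; last lra.
  by have := h _; rewrite ger0_norm// => /(_ zx); lra.
near=> n.
have nD : Ex P (fun w => (eps < `|V n w - Z n w|)%R%:R) <= eta.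
  by near: n; exact: VZ.
have n1 : Ex P (fun w => step_test m1 N1 (Z n w)) <= Ex chi (step_test m1 N1) + eta.
  have : `|Ex chi (step_test m1 N1) - Ex P (fun w => step_test m1 N1 (Z n w))| <= eta.
    by near: n; have /cvgrPdist_le := @cvg_Ex_step_test m1 N1; apply.
  by rewrite ler_norml => /andP[]; lra.
have n2 : Ex chi (step_test m2 N2) - eta <= Ex P (fun w => step_test m2 N2 (Z n w)).
  have : `|Ex chi (step_test m2 N2) - Ex P (fun w => step_test m2 N2 (Z n w))| <= eta.
    by near: n; have /cvgrPdist_le := @cvg_Ex_step_test m2 N2; apply.
  by rewrite ler_norml => /andP[]; lra.
have U : Ex P (fun w => (V n w <= x)%R%:R) <=
    Ex P (fun w => step_test m1 N1 (Z n w)) + eta +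
    Ex P (fun w => (eps < `|V n w - Z n w|)%R%:R).
  have bSe := bmfunD (bS m1 N1 n) bc.
  rewrite -[X in _ + X + _](Ex_cst P) -ExD// -ExD//.
  apply: Ex_le => //; first exact: bmfunD.
  move=> w; have [h _] := H1 (Z n w); have /andP[h0 _] := step_test01 m1 N1 (Z n w).
  by rewrite ger0_norm// in h; apply: indicator_le_above => //; exact: ltW.
have D : Ex P (fun w => step_test m2 N2 (Z n w)) <=
    Ex P (fun w => (V n w <= x)%R%:R) + eta +
    Ex P (fun w => (eps < `|V n w - Z n w|)%R%:R).
  have bVe := bmfunD (bV n x) bc.
  rewrite -[X in _ + X + _](Ex_cst P) -ExD// -ExD//.
  apply: Ex_le => //; first exact: bmfunD.
  move=> w; have [_ h] := H2 (Z n w); have /andP[_ h1] := step_test01 m2 N2 (Z n w).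
  by rewrite ger0_norm// in h; apply: indicator_ge_below => //; exact: ltW.
have eta05 : 5 * eta = eta0 by rewrite /eta mulrC divfK.
rewrite /= ler_norml; apply/andP; move: up lo nD n1 n2 U D; clear -eta05.
by move=> *; split; lra.
Unshelve. all: by end_near. Qed.

End laplace_criterion.

(** * Grades, ranks and the empirical covariance matrix *)

Section centered_triples.
Context d d' (T : measurableType d) (E : measurableType d') (R : realType).
Variables (P : probability T R) (X : nat -> {RV P >-> E}).
Hypothesis iidX : iid X.

(** Second moments involve at most four observations: one of them is averaged
    out while the three others, possibly equal to each other, are held fixed. *)
Lemma Ex_centered_triple (e0 : E) (h : E * E * E -> E -> R) (p q r i : nat) :
  bmfun (fun z => h z.1 z.2) ->
  (forall z, Ex P (fun w => h z (X 0%N w)) = 0) ->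
  i != p -> i != q -> i != r ->
  Ex P (fun w => h (X p w, X q w, X r w) (X i w)) = 0.
Proof.
move=> bh h0 ip iq ir; pose N := (p + q + r + i).+1.
have pN : (p < N)%N by rewrite /N; lia.
have qN : (q < N)%N by rewrite /N; lia.
have rN : (r < N)%N by rewrite /N; lia.
have iN : (i < N)%N by rewrite /N; lia.
pose po := Ordinal pN; pose qo := Ordinal qN; pose ro := Ordinal rN.
pose io := Ordinal iN.
pose g (t : N.-tuple E) := (tnth t po, tnth t qo, tnth t ro).
have mg : measurable_fun [set: N.-tuple E] g.
  by apply: measurable_fun_pair; [apply: measurable_fun_pair|];
    exact: measurable_tnth.
have := @Ex_centered0 _ _ _ _ _ _ _ iidX N io e0 (fun t x => h (g t) x).
have -> : (fun w => h (g (sample X N w)) (X io w)) =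
    fun w => h (X p w, X q w, X r w) (X i w).
  by apply/funext => w; rewrite /g !tnth_mktuple.
apply.
- have mgx : measurable_fun [set: N.-tuple E * E] (fun z => (g z.1, z.2)).
    by apply: measurable_fun_pair => //; exact: measurableT_comp.
  exact: (bmfun_comp bh mgx).
- move=> t t' x tt'; rewrite /g !tt'//; apply/eqP => /(congr1 val) /= /eqP.
  + by rewrite eq_sym (negbTE ir).
  + by rewrite eq_sym (negbTE iq).
  + by rewrite eq_sym (negbTE ip).
- by move=> t; exact: h0.
Qed.

End centered_triples.

Section grades.
Context d (T : measurableType d) (R : realType) (P : probability T R) (K : nat).
Variable X : nat -> {RV P >-> K.-tuple R}.
Hypothesis iidX : iid X.
Hypothesis contF : forall k : 'I_K, continuous (cdf (coord_rv X 0 k)).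
Implicit Types (k l : 'I_K) (x y : K.-tuple R) (t : R).

Definition marginal_cdf k t : R := fine (cdf (coord_rv X 0 k) t).

(** Under this scaling [Sigma] is the second moment matrix of the centered
    grades. *)
Definition cgrade k x : R := 2 * marginal_cdf k (tnth x k) - 1.

Definition sgn_cmp k x y : R :=
  (tnth x k <= tnth y k)%R%:R - (tnth y k <= tnth x k)%R%:R.

Lemma measurable_marginal_cdf k : measurable_fun [set: R] (marginal_cdf k).
Proof.
apply/measurable_EFinP; apply: eq_measurable_fun (cdf_measurable (coord_rv X 0 k)).
by move=> t _; rewrite /= /marginal_cdf fineK// fin_num_measure.
Qed.

Lemma marginal_cdf01 k t : 0 <= marginal_cdf k t <= 1.
Proof.
rewrite fine_ge0 ?cdf_ge0//= -lee_fin fineK ?cdf_le1//.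
by rewrite fin_num_measure.
Qed.

Lemma cgrade_le1 k x : `|cgrade k x| <= 1.
Proof.
by have /andP[] := marginal_cdf01 k (tnth x k); rewrite ler_norml /cgrade; lra.
Qed.

Lemma measurable_cgrade k : measurable_fun [set: K.-tuple R] (cgrade k).
Proof.
apply: measurable_funB => //; apply: measurable_funM => //.
by apply: (measurableT_comp (measurable_marginal_cdf k)); exact: measurable_tnth.
Qed.

Lemma bmfun_cgrade k : bmfun (cgrade k).
Proof. by split; [exact: measurable_cgrade|exists 1 => x; exact: cgrade_le1]. Qed.

Lemma bmfun_cgradeX k i : bmfun (fun w => cgrade k (X i w)).
Proof. by apply: (bmfun_comp (bmfun_cgrade k)); exact: measurable_funPT. Qed.

Lemma measurable_tnthX k i : measurable_fun [set: T] (fun w => tnth (X i w) k).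
Proof. exact: measurable_coord. Qed.

Lemma bmfun_le_fun d' (S : measurableType d') (f g : S -> R) :
  measurable_fun [set: S] f -> measurable_fun [set: S] g ->
  bmfun (fun z => (f z <= g z)%R%:R : R).
Proof. by move=> mf mg; apply: bmfun_bool; exact: measurable_fun_ler. Qed.

Lemma Ex_coord_le k t : Ex P (fun w => (tnth (X 0%N w) k <= t)%R%:R) = marginal_cdf k t.
Proof.
apply: EFin_inj; rewrite -Ex_bool; last first.
  by apply: measurable_fun_ler => //; exact: measurable_tnthX.
by rewrite /marginal_cdf fineK// fin_num_measure.
Qed.

(** Since [F] is continuous, its increment from [t - de / 2] to [t], which bounds
    the mass of the point [t], is arbitrarily small. *)
Lemma Ex_coord_eq k t : Ex P (fun w => (tnth (X 0%N w) k == t)%:R) = 0.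
Proof.
have mX := measurable_tnthX k 0.
have beq : bmfun (fun w => (tnth (X 0%N w) k == t)%:R : R).
  by apply: bmfun_bool; exact: measurable_fun_eqr.
apply/eqP; rewrite eq_le Ex_ge0 ?andbT//; apply/ler_addgt0Pl => e e0.
have : {for t, continuous (marginal_cdf k)}.
  apply: fine_cvg; rewrite fineK; last by rewrite fin_num_measure.
  exact: contF.
move=> /cvgrPdist_le/(_ _ e0)[de /= de0 H].
have /= := H (t - de / 2).
rewrite opprB addrCA subrr addr0 gtr0_norm ?divr_gt0// => /(_ ltac:(lra)) h.
rewrite addr0 (le_trans _ h)//; apply: le_trans (ler_norm _).
rewrite -!Ex_coord_le -ExB; [|exact: bmfun_le_fun|exact: bmfun_le_fun].
apply: Ex_le => //; first by apply: bmfunB; exact: bmfun_le_fun.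
move=> w; case: eqVneq => [->|_] /=.
  have -> : (t <= t - de / 2) = false by apply/negbTE; rewrite -ltNge; lra.
  by rewrite lexx subr0.
rewrite subr_ge0 ler_nat; case: (leP (tnth _ _) (t - _)) => //= h'.
by rewrite (le_trans h')// gerBl divr_ge0// ltW.
Qed.

Lemma Ex_coord_ge k t :
  Ex P (fun w => (t <= tnth (X 0%N w) k)%R%:R) = 1 - marginal_cdf k t.
Proof.
have mX := measurable_tnthX k 0.
have beq : bmfun (fun w => (tnth (X 0%N w) k == t)%:R : R).
  by apply: bmfun_bool; exact: measurable_fun_eqr.
have ble : bmfun (fun w => (tnth (X 0%N w) k <= t)%R%:R : R).
  exact: bmfun_le_fun.
transitivity (Ex P (fun w => (1 - (tnth (X 0%N w) k <= t)%R%:R) +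
   (tnth (X 0%N w) k == t)%:R)).
  by congr Ex; apply/funext => w; case: ltgtP => //= _; lra.
rewrite ExD//; last by apply: bmfunB => //; exact: bmfun_cst.
rewrite ExB//; last exact: bmfun_cst.
by rewrite Ex_cst Ex_coord_le Ex_coord_eq addr0.
Qed.

Lemma Ex_sgn_cmp_l k y : Ex P (fun w => sgn_cmp k (X 0%N w) y) = cgrade k y.
Proof.
have mX := measurable_tnthX k 0.
rewrite /sgn_cmp ExB; [|exact: bmfun_le_fun|exact: bmfun_le_fun].
by rewrite Ex_coord_le Ex_coord_ge /cgrade; ring.
Qed.

Lemma sgn_cmpC k x y : sgn_cmp k x y = - sgn_cmp k y x.
Proof. by rewrite /sgn_cmp opprB. Qed.

Lemma bmfun_sgn_cmp d' (S : measurableType d') k (f g : S -> K.-tuple R) :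
  measurable_fun [set: S] f -> measurable_fun [set: S] g ->
  bmfun (fun z => sgn_cmp k (f z) (g z)).
Proof.
have mt := measurable_tnth (T := measurableTypeR R) k.
move=> mf mg; apply: bmfunB; apply: bmfun_le_fun;
  exact: (measurableT_comp (measurable_tnth k)).
Qed.

Lemma Ex_sgn_cmp_r k x : Ex P (fun w => sgn_cmp k x (X 0%N w)) = - cgrade k x.
Proof.
under eq_fun do rewrite sgn_cmpC -mulN1r.
rewrite ExZ ?Ex_sgn_cmp_l ?mulN1r//.
by apply: bmfun_sgn_cmp => //; exact: measurable_funPT.
Qed.

Let e0 : K.-tuple R := [tuple 0 | _ < K].

(** The mean of [sgn_cmp] at two observations is, by averaging over the second
    one first, minus the mean grade, and by averaging over the first one first,
    the mean grade. *)
Lemma Ex_cgrade k : Ex P (fun w => cgrade k (X 0%N w)) = 0.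
Proof.
pose E := (K.-tuple R)%type.
have mf1 : measurable_fun [set: E * E * E * E] (fun z => z.1.1.1).
  by do 2 apply: measurableT_comp => //.
have bV1 := bmfun_comp (bmfun_cgrade k) mf1.
have b1 : bmfun (fun z : E * E * E * E => sgn_cmp k z.1.1.1 z.2 + cgrade k z.1.1.1).
  by apply: bmfunD => //; exact: bmfun_sgn_cmp.
have b2 : bmfun (fun z : E * E * E * E => sgn_cmp k z.2 z.1.1.1 - cgrade k z.1.1.1).
  by apply: bmfunB => //; exact: bmfun_sgn_cmp.
have bs x : bmfun (fun w => sgn_cmp k x (X 0%N w)).
  by apply: bmfun_sgn_cmp => //; exact: measurable_funPT.
have bs' x : bmfun (fun w => sgn_cmp k (X 0%N w) x).
  by apply: bmfun_sgn_cmp => //; exact: measurable_funPT.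
have bs01 : bmfun (fun w => sgn_cmp k (X 0%N w) (X 1%N w)).
  by apply: bmfun_sgn_cmp; exact: measurable_funPT.
have := @Ex_centered_triple _ _ _ _ _ _ _ iidX e0
  (fun z x => sgn_cmp k z.1.1 x + cgrade k z.1.1) 0 0 0 1 b1.
move=> /(_ _ isT isT isT) /= h1.
have := @Ex_centered_triple _ _ _ _ _ _ _ iidX e0
  (fun z x => sgn_cmp k x z.1.1 - cgrade k z.1.1) 1 1 1 0 b2.
move=> /(_ _ isT isT isT) /= h2.
have {h1} : Ex P (fun w => sgn_cmp k (X 0%N w) (X 1%N w) + cgrade k (X 0%N w)) = 0.
  apply: h1 => z; rewrite ExD//; last exact: bmfun_cst.
  by rewrite Ex_sgn_cmp_r Ex_cst addNr.
have {h2} : Ex P (fun w => sgn_cmp k (X 0%N w) (X 1%N w) - cgrade k (X 1%N w)) = 0.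
  apply: h2 => z; rewrite ExB//; last exact: bmfun_cst.
  by rewrite Ex_sgn_cmp_l Ex_cst subrr.
rewrite ExB//; last exact: bmfun_cgradeX.
rewrite ExD//; last exact: bmfun_cgradeX.
rewrite (Ex_iid iidX 1 (bmfun_cgrade k)); lra.
Qed.

(** The grades have mean [1 / 2], so that the factor [4] in [Sigma] turns their
    covariance into the second moment of the centered grades. *)
Lemma Ex_cgradeM k l :
  Ex P (fun w => cgrade k (X 0%N w) * cgrade l (X 0%N w)) = Sigma X k l.
Proof.
have gE q w : grade X q w = (cgrade q (X 0%N w) + 1) / 2.
  by rewrite /grade /cgrade /marginal_cdf -[coord_rv X 0 q w]/(tnth (X 0%N w) q); field.
have Eg q : fine ('E_P[grade X q])%E = 2^-1.
  rewrite unlock -[LHS]/(Ex P (grade X q)).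
  have -> : grade X q = fun w => 2^-1 * (cgrade q (X 0%N w) + 1).
    by apply/funext => w; rewrite gE mulrC.
  rewrite ExZ; last by apply: bmfunD; [exact: bmfun_cgradeX|exact: bmfun_cst].
  rewrite ExD ?Ex_cgrade ?Ex_cst ?add0r ?mulr1//; last exact: bmfun_cst.
  exact: bmfun_cgradeX.
rewrite [RHS]mxE covariance.unlock !Eg expectation.unlock.
rewrite -[fine _]/(Ex P ((grade X k \- cst 2^-1) * (grade X l \- cst 2^-1))%R).
rewrite -ExZ; last first.
  rewrite [X in bmfun X](_ : _ = fun w =>
      ((cgrade k (X 0%N w) + 1) / 2 - 2^-1) * ((cgrade l (X 0%N w) + 1) / 2 - 2^-1)).
    have bb q : bmfun (fun w => (cgrade q (X 0%N w) + 1) / 2 - 2^-1).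
      apply: bmfunB; last exact: bmfun_cst.
      apply: bmfunM; last exact: bmfun_cst.
      by apply: bmfunD; [exact: bmfun_cgradeX|exact: bmfun_cst].
    exact: bmfunM.
  by apply/funext => w /=; rewrite -!gE.
congr Ex; apply/funext => w.
rewrite -[RHS]/(4 * ((grade X k w - 2^-1) * (grade X l w - 2^-1))) !gE.
by field.
Qed.

(** What remains of the comparison kernel after removing its Hajek projection;
    it is degenerate in both arguments. *)
Definition resid k x y : R := sgn_cmp k x y - cgrade k y + cgrade k x.

Lemma resid3 k x y : `|resid k x y| <= 3.
Proof.
have := cgrade_le1 k x; have := cgrade_le1 k y; rewrite /resid /sgn_cmp !ler_norml.
by case: (tnth x k <= _); case: (tnth y k <= _) => /=; lra.
Qed.

Lemma bmfun_resid d' (S : measurableType d') k (f g : S -> K.-tuple R) :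
  measurable_fun [set: S] f -> measurable_fun [set: S] g ->
  bmfun (fun z => resid k (f z) (g z)).
Proof.
move=> mf mg; apply: bmfunD; last exact: (bmfun_comp (bmfun_cgrade k) mf).
apply: bmfunB; last exact: (bmfun_comp (bmfun_cgrade k) mg).
exact: bmfun_sgn_cmp.
Qed.

Lemma Ex_resid_r k x : Ex P (fun w => resid k x (X 0%N w)) = 0.
Proof.
have bs : bmfun (fun w => sgn_cmp k x (X 0%N w)).
  by apply: bmfun_sgn_cmp => //; exact: measurable_funPT.
have bv := bmfun_cgradeX k 0.
rewrite /resid ExD; [|exact: bmfunB|exact: bmfun_cst].
by rewrite ExB// Ex_cst Ex_cgrade Ex_sgn_cmp_r subr0 addNr.
Qed.

Lemma Ex_resid_l k y : Ex P (fun w => resid k (X 0%N w) y) = 0.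
Proof.
have bs : bmfun (fun w => sgn_cmp k (X 0%N w) y).
  by apply: bmfun_sgn_cmp => //; exact: measurable_funPT.
have bv := bmfun_cgradeX k 0.
have bc : bmfun (fun _ : T => cgrade k y) := bmfun_cst _ _.
rewrite /resid ExD//; last exact: bmfunB.
by rewrite ExB// Ex_cst Ex_cgrade Ex_sgn_cmp_l subrr addr0.
Qed.

(** If the second indices differ, average over [j']; otherwise the first ones
    differ, and average over [i']. *)
Lemma Ex_resid_orthogonal k (i j i' j' : nat) :
  i != j -> i != j' -> i' != j -> i' != j' -> (i, j) != (i', j') ->
  Ex P (fun w => resid k (X i w) (X j w) * resid k (X i' w) (X j' w)) = 0.
Proof.
move=> ij ij' i'j i'j' ne; pose E := (K.-tuple R)%type.
have m1 : measurable_fun [set: E * E * E * E] (fun z => z.1.1.1).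
  by do 2 apply: measurableT_comp => //.
have m2 : measurable_fun [set: E * E * E * E] (fun z => z.1.1.2).
  by do 2 apply: measurableT_comp => //.
have m3 : measurable_fun [set: E * E * E * E] (fun z => z.1.2).
  exact: measurableT_comp.
have br x : bmfun (fun w => resid k x (X 0%N w)).
  by apply: bmfun_resid => //; exact: measurable_funPT.
have br' x : bmfun (fun w => resid k (X 0%N w) x).
  by apply: bmfun_resid => //; exact: measurable_funPT.
have [jj'|jj'] := eqVneq j j'; last first.
  apply: (@Ex_centered_triple _ _ _ _ _ _ _ iidX e0
    (fun z x => resid k z.1.1 z.1.2 * resid k z.2 x) i j i' j').
  - by apply: bmfunM; exact: bmfun_resid.
  - by move=> z; rewrite ExZ ?Ex_resid_r ?mulr0.
  - by rewrite eq_sym.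
  - by rewrite eq_sym.
  - by rewrite eq_sym.
subst j'; apply: (@Ex_centered_triple _ _ _ _ _ _ _ iidX e0
    (fun z x => resid k z.1.1 z.1.2 * resid k x z.1.2) i j j i') => //.
- by apply: bmfunM; exact: bmfun_resid.
- by move=> z; rewrite ExZ ?Ex_resid_l ?mulr0.
- by apply: contra ne => /eqP ->.
Qed.

Lemma Ex_sqr_sum_resid k (a b : nat) :
  Ex P (fun w => (\sum_(i < a) \sum_(j < b)
    resid k (X i w) (X (a + j)%N w)) ^+ 2) <= (a * b)%:R * 3 ^+ 2.
Proof.
have -> : (fun w => (\sum_(i < a) \sum_(j < b)
    resid k (X i w) (X (a + j)%N w)) ^+ 2) =
  fun w => (\sum_(p : 'I_a * 'I_b) resid k (X p.1 w) (X (a + p.2)%N w)) ^+ 2.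
  by apply/funext => w; rewrite pair_bigA.
have <- : #|{: 'I_a * 'I_b}| = (a * b)%N by rewrite card_prod !card_ord.
apply: Ex_sqr_sum_orthogonal => [p|p w|p q pq].
- by apply: bmfun_resid; exact: measurable_funPT.
- exact: resid3.
have neq (i : 'I_a) (j : 'I_b) : (i : nat) != (a + j)%N.
  by rewrite ltn_eqF// (leq_trans (ltn_ord i))// leq_addr.
apply: Ex_resid_orthogonal => //; apply: contra pq.
case: p q => [p1 p2] [q1 q2] /= /eqP[] /val_inj -> /addnI /val_inj ->.
exact: eqxx.
Qed.

Lemma Ex_mean_cgradeM k l n : (0 < n)%N ->
  Ex P (fun w => `|n%:R^-1 * \sum_(i < n) cgrade k (X i w) * cgrade l (X i w)
    - Sigma X k l|) <= 2 * Num.sqrt n%:R^-1.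
Proof.
move=> n0; have n0' : 0 < n%:R :> R by rewrite ltr0n.
pose g x := cgrade k x * cgrade l x - Sigma X k l.
have bg : bmfun g.
  by apply: bmfunB; [apply: bmfunM; exact: bmfun_cgrade|exact: bmfun_cst].
have bgX i : bmfun (fun w => g (X i w)).
  by apply: (bmfun_comp bg); exact: measurable_funPT.
have VV1 x : `|cgrade k x * cgrade l x| <= 1.
  by rewrite normrM mulr_ile1// cgrade_le1.
have S1 : `|Sigma X k l| <= 1.
  by rewrite -Ex_cgradeM; apply: Ex_norm_le => //; apply: bmfunM; exact: bmfun_cgradeX.
have g2 x : `|g x| <= 2.
  by rewrite (le_trans (ler_normB _ _))// -[2]/(1 + 1) lerD.
have Eg : Ex P (fun w => g (X 0%N w)) = 0.
  rewrite ExB; [|by apply: bmfunM; exact: bmfun_cgradeX|exact: bmfun_cst].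
  by rewrite Ex_cgradeM Ex_cst subrr.
have E2 : Ex P (fun w => (\sum_(i < n) g (X i w)) ^+ 2) <= n%:R * 2 ^+ 2.
  rewrite -[in leRHS](card_ord n); apply: Ex_sqr_sum_orthogonal => // i j ij.
  apply: (@Ex_centered_triple _ _ _ _ _ _ _ iidX e0
    (fun z x => g z.1.1 * g x) i i i j); rewrite ?(eq_sym (j : nat))//.
    apply: bmfunM; last by apply: (bmfun_comp bg).
    by apply: (bmfun_comp bg); do 2 apply: measurableT_comp => //.
  by move=> z; rewrite ExZ ?Eg ?mulr0.
have -> : (fun w => `|n%:R^-1 * \sum_(i < n) cgrade k (X i w) * cgrade l (X i w)
    - Sigma X k l|) = fun w => n%:R^-1 * `|\sum_(i < n) g (X i w)|.
  apply/funext => w; rewrite -{2}[n%:R^-1]gtr0_norm ?invr_gt0// -normrM.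
  congr (`|_|); rewrite /g sumrB mulrBr sumr_const card_ord; congr (_ - _).
  by rewrite -[X in _ * X]mulr_natl mulKf// gt_eqF.
have bs : bmfun (fun w => \sum_(i < n) g (X i w)) by exact: bmfun_sum.
rewrite ExZ; last exact: bmfun_norm.
rewrite -(@ler_pXn2r _ 2)// ?nnegrE ?mulr_ge0 ?invr_ge0 ?sqrtr_ge0//; last first.
  by apply: Ex_ge0.
rewrite !exprMn sqr_sqrtr ?invr_ge0// exprVn ler_pdivrMl ?exprn_gt0//.
rewrite (le_trans (Ex_norm_sqr P bs))// (le_trans E2)//.
rewrite le_eqVlt; apply/orP; left; apply/eqP; field.
by rewrite gt_eqF.
Qed.

(** Given the observation [i], the deviations of the indicators
    [X_j <= X_i] from their conditional mean are centered and independent,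
    hence orthogonal. The term [j = i] is harmless: it stays orthogonal to the
    others, each of which is centered given [X_i]. *)
Lemma Ex_norm_ecdf_error k n (i : nat) : (0 < n)%N ->
  Ex P (fun w => `|(2 * ecdf (fun j => X j w) n k (tnth (X i w) k) - 1)
    - cgrade k (X i w)|) <= 2 * Num.sqrt n%:R^-1.
Proof.
move=> n0; have n0' : 0 < n%:R :> R by rewrite ltr0n.
pose E := (K.-tuple R)%type.
pose g x y : R := (tnth y k <= tnth x k)%R%:R - marginal_cdf k (tnth x k).
have bg d' (S : measurableType d') (p q : S -> E) :
    measurable_fun [set: S] p -> measurable_fun [set: S] q ->
    bmfun (fun z => g (p z) (q z)).
  move=> mp mq; have mpk : measurable_fun [set: S] (fun z => tnth (p z) k).
    exact: (measurableT_comp (measurable_tnth k)).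
  apply: bmfunB; first apply: bmfun_le_fun => //.
    exact: (measurableT_comp (measurable_tnth k)).
  split; first exact: (measurableT_comp (measurable_marginal_cdf k)).
  exists 1 => z; have /andP[? ?] := marginal_cdf01 k (tnth (p z) k).
  by rewrite ger0_norm.
have g1 x y : `|g x y| <= 1.
  rewrite /g; have := marginal_cdf01 k (tnth x k); rewrite ler_norml.
  by case: (tnth y k <= _) => /=; lra.
have Eg x : Ex P (fun w => g x (X 0%N w)) = 0.
  rewrite ExB ?Ex_cst ?Ex_coord_le ?subrr//; last exact: bmfun_cst.
  by apply: bmfun_le_fun => //; exact: measurable_tnthX.
have bgx x : bmfun (fun w => g x (X 0%N w)).
  by apply: bg => //; exact: measurable_funPT.
have m1 : measurable_fun [set: E * E * E * E] (fun z => z.1.1.1).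
  by do 2 apply: measurableT_comp => //.
have m2 : measurable_fun [set: E * E * E * E] (fun z => z.1.1.2).
  by do 2 apply: measurableT_comp => //.
have bgg : bmfun (fun z : E * E * E * E => g z.1.1.1 z.1.1.2 * g z.1.1.1 z.2).
  by apply: bmfunM; exact: bg.
have bgX j : bmfun (fun w => g (X i w) (X j w)).
  by apply: bg; exact: measurable_funPT.
have ort j j' : j' != i -> j' != j ->
    Ex P (fun w => g (X i w) (X j w) * g (X i w) (X j' w)) = 0.
  move=> j'i j'j; apply: (@Ex_centered_triple _ _ _ _ _ _ _ iidX e0
    (fun z x => g z.1.1 z.1.2 * g z.1.1 x) i j i j' bgg) => //.
  by move=> z; rewrite ExZ ?Eg ?mulr0.
have E2 : Ex P (fun w => (\sum_(j < n) g (X i w) (X j w)) ^+ 2) <= n%:R * 1 ^+ 2.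
  rewrite -[in leRHS](card_ord n); apply: Ex_sqr_sum_orthogonal => // j j' jj'.
  have j'j : (j' : nat) != j by rewrite eq_sym.
  have [j'i|j'i] := eqVneq (j' : nat) i; last exact: ort.
  under eq_fun do rewrite mulrC.
  by apply: ort; rewrite // -j'i.
have -> : (fun w => `|(2 * ecdf (fun j => X j w) n k (tnth (X i w) k) - 1)
    - cgrade k (X i w)|) =
    fun w => (2 * n%:R^-1) * `|\sum_(j < n) g (X i w) (X j w)|.
  apply/funext => w; rewrite -[X in X * `|_|]gtr0_norm ?mulr_gt0 ?invr_gt0//.
  rewrite -normrM; congr (`|_|); rewrite /g sumrB sumr_const card_ord mulrBr.
  rewrite -[X in _ - _ * X]mulr_natl -!mulrA mulKf ?gt_eqF//.
  by rewrite /ecdf big_mkord /cgrade; ring.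
have bs : bmfun (fun w => \sum_(j < n) g (X i w) (X j w)) by exact: bmfun_sum.
rewrite ExZ; last exact: bmfun_norm.
rewrite -mulrA ler_wpM2l//.
rewrite -(@ler_pXn2r _ 2)// ?nnegrE ?mulr_ge0 ?invr_ge0 ?sqrtr_ge0//; last first.
  by apply: Ex_ge0.
rewrite !exprMn sqr_sqrtr ?invr_ge0// exprVn ler_pdivrMl ?exprn_gt0//.
rewrite (le_trans (Ex_norm_sqr P bs))// (le_trans E2)//.
rewrite le_eqVlt; apply/orP; left; apply/eqP; field.
by rewrite gt_eqF.
Qed.

Lemma measurable_ecdfX k n i : measurable_fun [set: T]
  (fun w => ecdf (fun j => X j w) n k (tnth (X i w) k)).
Proof.
apply: measurable_funM => //; apply: measurable_sum => j.
suff [] : bmfun (fun w => (tnth (X j w) k <= tnth (X i w) k)%R%:R : R) by [].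
by apply: bmfun_le_fun; exact: measurable_tnthX.
Qed.

Lemma ecdf01 (x : nat -> K.-tuple R) n k t : (0 < n)%N -> 0 <= ecdf x n k t <= 1.
Proof.
move=> n0; have n0' : 0 < n%:R :> R by rewrite ltr0n.
rewrite /ecdf big_mkord mulr_ge0 ?invr_ge0 ?sumr_ge0//=.
rewrite ler_pdivrMl// mulr1 -[X in _ <= X%:R]card_ord -sum1_card natr_sum.
by apply: ler_sum => j _; rewrite ler_nat leq_b1.
Qed.

Lemma bmfun_ecdfX k n i : (0 < n)%N ->
  bmfun (fun w => 2 * ecdf (fun j => X j w) n k (tnth (X i w) k) - 1).
Proof.
move=> n0; apply: bmfunB; last exact: bmfun_cst.
apply: bmfunZ; split; first exact: measurable_ecdfX.
exists 1 => w.
have /andP[h0 h1] := ecdf01 (fun j => X j w) k (tnth (X i w) k) n0.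
by rewrite ger0_norm.
Qed.

Lemma hatSigmaE (x : nat -> K.-tuple R) n k l : hatSigma x n k l =
  n%:R^-1 * \sum_(i < n) (2 * ecdf x n k (tnth (x i) k) - 1) *
    (2 * ecdf x n l (tnth (x i) l) - 1).
Proof.
rewrite mxE big_mkord -mulrA mulrCA mulr_sumr; congr (_ * _).
by apply: eq_bigr => i _; field.
Qed.

Lemma bmfun_hatSigma n k l : (0 < n)%N ->
  bmfun (fun w => hatSigma (fun j => X j w) n k l).
Proof.
move=> n0; under eq_fun do rewrite hatSigmaE.
by apply: bmfunZ; apply: bmfun_sum => i _; apply: bmfunM; exact: bmfun_ecdfX.
Qed.

(** Replacing the empirical grades by the grades costs two empirical errors per
    observation, as all the factors are bounded by one; the law of large numbers
    accounts for the rest. *)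
Lemma Ex_norm_hatSigma_error k l n : (0 < n)%N ->
  Ex P (fun w => `|hatSigma (fun j => X j w) n k l - Sigma X k l|) <=
  6 * Num.sqrt n%:R^-1.
Proof.
move=> n0; have n0' : 0 < n%:R :> R by rewrite ltr0n.
pose Vh q i w := 2 * ecdf (fun j => X j w) n q (tnth (X i w) q) - 1.
pose D q i w := `|Vh q i w - cgrade q (X i w)|.
have bD q i : bmfun (D q i).
  by apply: bmfun_norm; apply: bmfunB; [exact: bmfun_ecdfX|exact: bmfun_cgradeX].
pose G w := `|n%:R^-1 * \sum_(i < n) cgrade k (X i w) * cgrade l (X i w) - Sigma X k l|.
have bG : bmfun G.
  apply: bmfun_norm; apply: bmfunB; last exact: bmfun_cst.
  by apply: bmfunZ; apply: bmfun_sum => i _; apply: bmfunM; exact: bmfun_cgradeX.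
have bS : bmfun (fun w => \sum_(i < n) (D k i w + D l i w)).
  by apply: bmfun_sum => i _; exact: bmfunD.
apply: (@le_trans _ _
    (Ex P (fun w => n%:R^-1 * \sum_(i < n) (D k i w + D l i w) + G w))).
  apply: Ex_le => [||w].
  - by apply: bmfun_norm; apply: bmfunB; [exact: bmfun_hatSigma|exact: bmfun_cst].
  - by apply: bmfunD => //; exact: bmfunZ.
  rewrite hatSigmaE -[X in `|X - _|](subrK (n%:R^-1 *
    \sum_(i < n) cgrade k (X i w) * cgrade l (X i w))) -addrA.
  rewrite (le_trans (ler_normD _ _))// lerD2r -mulrBr normrM gtr0_norm ?invr_gt0//.
  rewrite ler_wpM2l ?invr_ge0// -sumrB (le_trans (ler_norm_sum _ _ _))//.
  apply: ler_sum => i _; rewrite -!/(Vh _ _ _).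
  have Vh1 : `|Vh l i w| <= 1.
    have /andP[? ?] := ecdf01 (fun j => X j w) l (tnth (X i w) l) n0.
    by rewrite ler_norml /Vh; lra.
  have -> : Vh k i w * Vh l i w - cgrade k (X i w) * cgrade l (X i w) =
    (Vh k i w - cgrade k (X i w)) * Vh l i w +
    cgrade k (X i w) * (Vh l i w - cgrade l (X i w)).
    by ring.
  rewrite (le_trans (ler_normD _ _))// !normrM lerD//.
    by rewrite ler_piMr.
  by rewrite ler_piMl// cgrade_le1.
rewrite ExD//; last exact: bmfunZ.
rewrite ExZ// Ex_sum; last by move=> i _; exact: bmfunD.
set r := Num.sqrt _.
have -> : 6 * r = n%:R^-1 * (\sum_(i < n) 4 * r) + 2 * r.
  rewrite sumr_const card_ord -[(4 * r) *+ n]mulr_natl mulKf ?gt_eqF//; ring.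
apply: lerD; last exact: Ex_mean_cgradeM.
rewrite ler_wpM2l ?invr_ge0//; apply: ler_sum => i _.
rewrite ExD//; have := Ex_norm_ecdf_error k i n0; have := Ex_norm_ecdf_error l i n0.
rewrite -/r -!/(Ex P _); rewrite /D /Vh; lra.
Qed.

Lemma Ex_sqr_weighted k n (a : nat -> R) (C0 : R) : (0 < n)%N -> 0 <= C0 ->
  (forall j, (j < n)%N -> a j ^+ 2 <= C0 / n%:R) ->
  Ex P (fun w => (\sum_(0 <= j < n) a j * cgrade k (X j w)) ^+ 2) <= C0.
Proof.
move=> n0 C00 aC; have n0' : 0 < n%:R :> R by rewrite ltr0n.
have Cn : 0 <= C0 / n%:R by rewrite divr_ge0// ltW.
under eq_fun do rewrite big_mkord.
have bv (j : 'I_n) : bmfun (fun w => a j * cgrade k (X j w)).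
  by apply: bmfunZ; exact: bmfun_cgradeX.
apply: (@le_trans _ _ (#|'I_n|%:R * (Num.sqrt (C0 / n%:R)) ^+ 2)); last first.
  by rewrite card_ord sqr_sqrtr// mulrC divfK// gt_eqF.
apply: Ex_sqr_sum_orthogonal => // [j w|i j ij].
  rewrite normrM -[leRHS]mulr1 ler_pM ?cgrade_le1// -sqrtr_sqr ler_wsqrtr// aC//.
under eq_fun do rewrite mulrACA.
rewrite ExZ; last by apply: bmfunM; exact: bmfun_cgradeX.
rewrite [X in _ * X](_ : _ = 0) ?mulr0//.
apply: (@Ex_centered_triple _ _ _ _ _ _ _ iidX e0
    (fun z x => cgrade k z.1.1 * cgrade k x) i i i j); rewrite ?(eq_sym (j : nat))//.
  apply: bmfunM; last by apply: (bmfun_comp (bmfun_cgrade k)).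
  by apply: (bmfun_comp (bmfun_cgrade k)); do 2 apply: measurableT_comp => //.
by move=> z; rewrite ExZ ?Ex_cgrade ?mulr0//; exact: bmfun_cgradeX.
Qed.

End grades.

(** * Continuity of the quadratic form in the inverse matrix *)

Section matrix_inverse.
Variable R : realType.

Lemma cvg_det (I : Type) (F : set_system I) (FF : Filter F) n
    (A : I -> 'M[R]_n) (L : 'M[R]_n) :
  (forall i j, A t i j @[t --> F] --> L i j) ->
  \det (A t) @[t --> F] --> \det L.
Proof.
move=> AL; rewrite /determinant.
apply: cvg_big => [|s _]; first exact: add_continuous.
apply: cvgM; first exact: cvg_cst.
by apply: cvg_big => [|i _]; [exact: mul_continuous|exact: AL].
Qed.

Lemma cvg_adjugate (I : Type) (F : set_system I) (FF : Filter F) n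
    (A : I -> 'M[R]_n) (L : 'M[R]_n) :
  (forall i j, A t i j @[t --> F] --> L i j) ->
  forall i j, (\adj (A t)) i j @[t --> F] --> (\adj L) i j.
Proof.
move=> AL i j; rewrite mxE; under eq_fun do rewrite mxE; rewrite /cofactor.
apply: cvgM; first exact: cvg_cst.
apply: cvg_det => k l; under eq_fun do rewrite !mxE.
by rewrite !mxE; exact: AL.
Qed.

Lemma cvg_detV_adjugate (I : Type) (F : set_system I) (FF : Filter F) n
    (A : I -> 'M[R]_n) (L : 'M[R]_n) : \det L != 0 ->
  (forall i j, A t i j @[t --> F] --> L i j) ->
  forall i j, (\det (A t))^-1 * (\adj (A t)) i j @[t --> F] -->
    (\det L)^-1 * (\adj L) i j.
Proof.
move=> dL AL i j; apply: cvgM; last exact: cvg_adjugate.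
by apply: cvgV => //; exact: cvg_det.
Qed.

Lemma near_invmx n (L : 'M[R]_n) (e : R) : L \in unitmx -> 0 < e ->
  exists2 de : R, 0 < de & forall M : 'M[R]_n,
    (forall i j, `|L i j - M i j| < de) ->
    M \in unitmx /\ forall i j, `|invmx L i j - invmx M i j| <= e.
Proof.
move=> uL e0; have dL : \det L != 0 by move: uL; rewrite unitmxE unitfE.
have cM i j : M i j @[M --> L] --> L i j by exact: coord_continuous.
have cdet : \det M @[M --> L] --> \det L by exact: (@cvg_det _ (nbhs L) _ _ id L cM).
have cinv i j : (\det M)^-1 * (\adj M) i j @[M --> L] -->
    (\det L)^-1 * (\adj L) i j by
  exact: (@cvg_detV_adjugate _ (nbhs L) _ _ id L dL cM).
have : \forall M \near L, M \in unitmx /\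
    forall i j, `|invmx L i j - invmx M i j| <= e.
  have nu : \forall M \near L, M \in unitmx.
    near=> M; rewrite unitmxE unitfE; near: M.
    exact: cvgr_neq0 cdet dL.
  pose close (i j : 'I_n) : set 'M[R]_n := [set M |
    `|(\det L)^-1 * (\adj L) i j - (\det M)^-1 * (\adj M) i j| <= e].
  have ni : \forall M \near L, forall i j, close i j M.
    apply: (@filter_forall _ _ (fun i M => forall j, close i j M) (nbhs L)) => i.
    apply: (@filter_forall _ _ (close i) (nbhs L)) => j.
    by have /cvgrPdist_le := cinv i j; apply.
  near=> M; have uM : M \in unitmx by near: M.
  split => // i j; rewrite /invmx uL uM !mxE.
  have : forall i j, close i j M by near: M.
  by move=> /(_ i j); rewrite /close /= !mxE.
move=> /nbhs_ballP[de /= de0 H]; exists de => // M LM.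
by apply: H; split => // i j; exact: LM.
Unshelve. all: by end_near. Qed.

End matrix_inverse.

Section quadratic_perturbation.
Variables (R : realType) (K : nat).
Implicit Types (A M : 'M[R]_K) (U S : 'cV[R]_K).

Lemma bform_mxB A M U S : bform (A - M) U S = bform A U S - bform M U S.
Proof. by rewrite /bform mulmxBr mulmxBl !mxE. Qed.

Lemma bformBl A U S z : bform A (U - S) z = bform A U z - bform A S z.
Proof. by rewrite bformDl -scaleN1r bformZl mulN1r. Qed.

Lemma bformBr A U S z : bform A z (U - S) = bform A z U - bform A z S.
Proof. by rewrite bformDr -scaleN1r bformZr mulN1r. Qed.

(** The continuity in [U] and [S] is uniform over the bounded set where [S]
    lives; this is what makes it usable in probability. *)
Lemma near_quadratic A (B e : R) : A \in unitmx -> 0 <= B -> 0 < e ->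
  exists2 de : R, 0 < de & forall M U S,
    (forall i j, `|M i j - A i j| < de) ->
    (forall k, `|U k 0 - S k 0| < de) -> (forall k, `|S k 0| <= B) ->
    M \in unitmx /\ `|bform (invmx M) U U - bform (invmx A) S S| <= e.
Proof.
move=> uA B0 e0; pose Q := entry_norm (invmx A).
have Q0 : 0 <= Q := entry_norm_ge0 _.
pose B1 := B + 1; have B10 : 0 < B1 by rewrite /B1; lra.
pose c := 1 + B1 * B1 * (K * K)%:R.
have c0 : 0 < c by rewrite ltr_pwDl// !mulr_ge0// ltW.
have e1 : 0 < e / 2 / c by rewrite !divr_gt0.
have [d1 d10 H1] := near_invmx uA e1.
pose q := 1 + 2 * B1 * Q.
have q0 : 0 < q by rewrite ltr_pwDl// !mulr_ge0// ltW.
pose d2 := e / 2 / q; have d20 : 0 < d2 by rewrite !divr_gt0.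
pose de := Num.min 1 (Num.min d1 d2).
have [de1 ded1 ded2] : [/\ de <= 1, de <= d1 & de <= d2].
  by rewrite /de; split; rewrite !ge_min lexx ?orbT.
have de0 : 0 < de by rewrite !lt_min ltr01 d10.
exists de => // M U S MA US SB.
have [uM invM] : M \in unitmx /\
    forall i j, `|invmx A i j - invmx M i j| <= e / 2 / c.
  by apply: H1 => i j; rewrite distrC (lt_le_trans (MA i j)).
split=> //.
have SB1 k : `|S k 0| <= B1 by rewrite (le_trans (SB k))// lerDl.
have UB1 k : `|U k 0| <= B1.
  rewrite -(subrK (S k 0) (U k 0)) (le_trans (ler_normD _ _))// addrC lerD//.
  by rewrite ltW// (lt_le_trans (US k)).
have -> : bform (invmx M) U U - bform (invmx A) S S =
  - bform (invmx A - invmx M) U U +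
  (bform (invmx A) (U - S) U + bform (invmx A) S (U - S)).
  by rewrite bform_mxB bformBl bformBr; ring.
have h1 : `|bform (invmx A - invmx M) U U| <= e / 2.
  apply: (@le_trans _ _ (B1 * B1 * entry_norm (invmx A - invmx M))).
    by apply: bform_bound => //; exact: ltW.
  apply: (@le_trans _ _ (B1 * B1 * ((K * K)%:R * (e / 2 / c)))).
    rewrite ler_wpM2l ?mulr_ge0 ?(ltW B10)// /entry_norm.
    apply: (@le_trans _ _ (\sum_(k < K) \sum_(l < K) (e / 2 / c))).
      by apply: ler_sum => k _; apply: ler_sum => l _; rewrite !mxE.
    by rewrite !sumr_const card_ord -mulrnA mulr_natl.
  have -> : B1 * B1 * ((K * K)%:R * (e / 2 / c)) =
    e / 2 * (B1 * B1 * (K * K)%:R / c) by ring.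
  by rewrite ler_piMr ?divr_ge0 ?(ltW e0)// ler_pdivrMr// mul1r /c lerDr.
have h2 : de * B1 * Q + B1 * de * Q <= e / 2.
  have -> : de * B1 * Q + B1 * de * Q = de * (2 * B1 * Q) by ring.
  apply: (@le_trans _ _ (d2 * q)); last by rewrite /d2 divfK// gt_eqF.
  by apply: ler_pM => //; rewrite ?(ltW de0) ?mulr_ge0 ?(ltW B10)// /q lerDr.
have USde k : `|(U - S) k 0| <= de by rewrite !mxE ltW.
have h3 : `|bform (invmx A) (U - S) U| <= de * B1 * Q.
  by apply: bform_bound => //; exact: ltW.
have h4 : `|bform (invmx A) S (U - S)| <= B1 * de * Q.
  by apply: bform_bound => //; exact: ltW.
rewrite (le_trans (ler_normD _ _))// normrN.
have := ler_normD (bform (invmx A) (U - S) U) (bform (invmx A) S (U - S)).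
by move: h1 h2 h3 h4; lra.
Qed.

End quadratic_perturbation.

(** * The Hajek projection of the change-point vector *)

Section weights.
Variable R : realType.

Definition cp_scale (n n1 : nat) : R :=
  (Num.sqrt (n%:R * n1%:R * (n%:R - n1%:R)))^-1.

(** Summing [g (X j) - g (X i)] over all pairs gives each later observation the
    multiplicity [n1] and each earlier one the multiplicity [- (n - n1)]. *)
Definition weight (n n1 j : nat) : R :=
  cp_scale n n1 * (if (j < n1)%N then - (n%:R - n1%:R) else n1%:R).

Lemma cp_scale_sqr n n1 : (0 < n1 < n)%N ->
  cp_scale n n1 ^+ 2 = (n%:R * n1%:R * (n%:R - n1%:R))^-1.
Proof.
move=> /andP[n10 n1n]; rewrite exprVn sqr_sqrtr// !mulr_ge0// subr_ge0 ler_nat.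
exact: ltnW.
Qed.

Lemma sum_nat_split n n1 (f : nat -> R) : (n1 <= n)%N ->
  \sum_(0 <= j < n) f j = \sum_(i < n1) f i + \sum_(j < n - n1) f (n1 + j)%N.
Proof.
move=> n1n; rewrite (big_cat_nat _ n1n)//= big_mkord; congr (_ + _).
rewrite -{1}[n1]add0n big_addn big_mkord; apply: eq_bigr => j _.
by rewrite addnC.
Qed.

Lemma weight_lt n n1 j : (j < n1)%N ->
  weight n n1 j = - (cp_scale n n1 * (n%:R - n1%:R)).
Proof. by move=> jn; rewrite /weight jn mulrN. Qed.

Lemma weight_ge n n1 j : weight n n1 (n1 + j) = cp_scale n n1 * n1%:R.
Proof. by rewrite /weight ltnNge leq_addr. Qed.

Lemma sum_weight_sqr n n1 : (0 < n1 < n)%N ->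
  \sum_(0 <= j < n) weight n n1 j ^+ 2 = 1.
Proof.
move=> h; have /andP[n10 n1n] := h; have n1n' := ltnW n1n.
rewrite (sum_nat_split _ n1n').
under eq_bigr => j _ do rewrite (weight_lt _ (ltn_ord j)) sqrrN.
under [X in _ + X]eq_bigr => j _ do rewrite weight_ge.
rewrite !sumr_const !card_ord -[X in X + _]mulr_natr -[X in _ + X]mulr_natr.
rewrite natrB// !exprMn (cp_scale_sqr h).
have n0 : n%:R != 0 :> R by rewrite pnatr_eq0; lia.
have n10' : n1%:R != 0 :> R by rewrite pnatr_eq0; lia.
have m0 : n%:R - n1%:R != 0 :> R by rewrite subr_eq0 eqr_nat; lia.
by field; rewrite n0 n10' m0.
Qed.

Lemma weight_sqr_le n n1 j (tau : R) : (0 < n1 < n)%N -> 0 < tau ->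
  tau * n%:R <= n1%:R -> tau * n%:R <= n%:R - n1%:R ->
  weight n n1 j ^+ 2 <= tau^-1 / n%:R.
Proof.
move=> h tau0 h1 h2; have /andP[n10 n1n] := h.
have n0 : 0 < n%:R :> R by rewrite ltr0n; lia.
have n10' : 0 < n1%:R :> R by rewrite ltr0n.
have m0 : 0 < n%:R - n1%:R :> R by rewrite subr_gt0 ltr_nat.
rewrite /weight exprMn (cp_scale_sqr h).
have -> : tau^-1 / n%:R = (tau * n%:R)^-1 by rewrite invfM.
have tn0 : 0 < tau * n%:R by rewrite mulr_gt0.
have [jn|jn] := ltnP j n1.
  have -> : (n%:R * n1%:R * (n%:R - n1%:R))^-1 * (- (n%:R - n1%:R)) ^+ 2 =
      (n%:R - n1%:R) / n%:R * n1%:R^-1 :> R by field; rewrite !gt_eqF.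
  apply: (@le_trans _ _ n1%:R^-1).
    by rewrite ler_piMl ?invr_ge0// ler_pdivrMr// mul1r gerBl.
  by rewrite lef_pV2.
have -> : (n%:R * n1%:R * (n%:R - n1%:R))^-1 * n1%:R ^+ 2 =
    n1%:R / n%:R * (n%:R - n1%:R)^-1 :> R by field; rewrite !gt_eqF.
apply: (@le_trans _ _ (n%:R - n1%:R)^-1).
  by rewrite ler_piMl ?invr_ge0 ?ltW// ltr_pdivrMr// mul1r ltr_nat.
by rewrite lef_pV2.
Qed.

Lemma sum_weight_projection n n1 (f : nat -> R) : (n1 <= n)%N ->
  \sum_(0 <= j < n) weight n n1 j * f j = cp_scale n n1 *
    \sum_(i < n1) \sum_(j < n - n1) (f (n1 + j)%N - f i).
Proof.
move=> n1n; rewrite (sum_nat_split _ n1n).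
under eq_bigr => j _ do rewrite (weight_lt _ (ltn_ord j)) mulNr.
under [X in _ + X]eq_bigr => j _ do rewrite weight_ge.
under [X in _ = _ * X]eq_bigr => i _.
  rewrite sumrB sumr_const card_ord -mulr_natl natrB//; over.
rewrite sumrB sumr_const card_ord -[X in _ = _ * (X - _)]mulr_natl.
rewrite sumrN -!mulr_sumr; ring.
Qed.

End weights.

Section projection.
Context d (T : measurableType d) (R : realType) (P : probability T R) (K : nat).
Variable X : nat -> {RV P >-> K.-tuple R}.

Lemma change_point_vecE (x : nat -> K.-tuple R) n n1 k : (n1 <= n)%N ->
  change_point_vec x n n1 k 0 =
  \sum_(0 <= j < n) weight R n n1 j * cgrade X k (x j) +
  cp_scale R n n1 *
    \sum_(i < n1) \sum_(j < n - n1) resid X k (x i) (x (n1 + j)%N).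
Proof.
move=> n1n; rewrite (sum_weight_projection (fun j => cgrade X k (x j)) n1n) -mulrDr.
rewrite mxE; congr (_ * _); rewrite -big_split/= big_mkord.
apply: eq_bigr => i _; rewrite -big_split/=.
rewrite -{1}[n1]add0n big_addn big_mkord; apply: eq_bigr => j _.
by rewrite /resid /sgn_cmp addnC; ring.
Qed.

Hypothesis iidX : iid X.
Hypothesis contF : forall k : 'I_K, continuous (cdf (coord_rv X 0 k)).

Definition proj_sum n n1 k (w : T) : R :=
  \sum_(0 <= j < n) weight R n n1 j * cgrade X k (X j w).

Lemma bmfun_change_point_vec n n1 k : (n1 <= n)%N ->
  bmfun (fun w => change_point_vec (fun i => X i w) n n1 k 0).
Proof.
move=> n1n; under eq_fun do rewrite mxE.
apply: bmfunZ; do 2 apply: bmfun_sum => ? _.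
by apply: bmfun_sgn_cmp; exact: measurable_funPT.
Qed.

Lemma bmfun_proj_sum n n1 k : bmfun (proj_sum n n1 k).
Proof. by apply: bmfun_sum => j _; apply: bmfunZ; exact: bmfun_cgradeX. Qed.

Lemma Ex_sqr_projection_error n n1 k : (0 < n1 < n)%N ->
  Ex P (fun w => (change_point_vec (fun i => X i w) n n1 k 0 -
    proj_sum n n1 k w) ^+ 2) <= 9 / n%:R.
Proof.
move=> h; have /andP[n10 n1n] := h; have n1n' := ltnW n1n.
under eq_fun do rewrite (change_point_vecE _ _ n1n') addrC addKr exprMn.
rewrite ExZ; last first.
  apply: bmfunX; do 2 apply: bmfun_sum => ? _.
  by apply: bmfun_resid; exact: measurable_funPT.
have n0 : 0 < n%:R :> R by rewrite ltr0n; lia.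
have n10' : 0 < n1%:R :> R by rewrite ltr0n.
have m0 : 0 < n%:R - n1%:R :> R by rewrite subr_gt0 ltr_nat.
apply: (@le_trans _ _ (cp_scale R n n1 ^+ 2 * ((n1 * (n - n1))%:R * 3 ^+ 2))).
  by rewrite ler_wpM2l ?sqr_ge0//; exact: Ex_sqr_sum_resid.
rewrite (cp_scale_sqr _ h) natrM natrB// le_eqVlt; apply/orP; left; apply/eqP.
by field; rewrite !gt_eqF.
Qed.

End projection.

(** * The limit of the test statistic *)

Section posdef.
Variables (R : realType) (K : nat).
Implicit Types A : 'M[R]_K.

(** A row of the left kernel gives a vector on which the form vanishes. *)
Lemma posdefmx_unit A : posdefmx A -> A \in unitmx.
Proof.
move=> [symA posA]; rewrite -row_free_unit -kermx_eq0; apply/eqP/row_matrixP => i.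
rewrite row0; apply/eqP; case: eqVneq => // ki0.
have : (row i (kermx A))^T != 0 by rewrite trmx_eq0.
move=> /posA; rewrite trmxK.
by rewrite -row_mul mulmx_ker row0 mul0mx mxE ltxx.
Qed.

Lemma posdefmx_inv_sym A : posdefmx A -> (invmx A)^T = invmx A.
Proof. by move=> [symA _]; rewrite trmx_inv symA. Qed.

Lemma posdefmx_inv_ge0 A x : posdefmx A -> 0 <= bform (invmx A) x x.
Proof.
move=> pA; have uA := posdefmx_unit pA; have [symA posA] := pA.
have -> : bform (invmx A) x x = bform A (invmx A *m x) (invmx A *m x).
  rewrite /bform trmx_mul posdefmx_inv_sym// -!mulmxA mulKVmx//.
have [->|x0] := eqVneq (invmx A *m x) 0; first by rewrite /bform mulmx0 mxE.
exact/ltW/posA.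
Qed.

End posdef.

Section limit.
Context d (T : measurableType d) (R : realType) (P : probability T R) (K : nat).
Variables (X : nat -> {RV P >-> K.-tuple R}) (n1 : nat -> nat) (t1 : R).
Variable c : nat -> {RV P >-> R}.
Hypothesis iidX : iid X.
Hypothesis contF : forall k : 'I_K, continuous (cdf (coord_rv X 0 k)).
Hypothesis t01 : 0 < t1 < 1.
Hypothesis n1t : (n1 n)%:R / n%:R @[n --> \oo] --> t1.
Hypothesis pdS : posdefmx (Sigma X).

Let A := invmx (Sigma X).
Let tau := Num.min t1 (1 - t1) / 2.

Let tau0 : 0 < tau.
Proof. by move: t01 => /andP[? ?]; rewrite divr_gt0// lt_min subr_gt0; apply/andP. Qed.

Lemma near_balanced : \forall n \near \oo,
  [/\ (0 < n1 n < n)%N, tau * n%:R <= (n1 n)%:R &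
      tau * n%:R <= n%:R - (n1 n)%:R].
Proof.
have [tt tt'] : 2 * tau <= t1 /\ 2 * tau <= 1 - t1.
  by rewrite /tau mulrC divfK// !ge_min !lexx orbT.
near=> n.
have n0 : (0 < n)%N by near: n; exact: nbhs_infty_gt.
have n0' : 0 < n%:R :> R by rewrite ltr0n.
have : `|t1 - (n1 n)%:R / n%:R| <= tau.
  by near: n; have /cvgrPdist_le := n1t; apply.
rewrite ler_norml => /andP[h1 h2].
have a1 : tau * n%:R <= (n1 n)%:R by rewrite -ler_pdivlMr//; lra.
have a2 : tau * n%:R <= n%:R - (n1 n)%:R.
  have : (n1 n)%:R <= (1 - tau) * n%:R by rewrite -ler_pdivrMr//; lra.
  lra.
split=> //; have tn : 0 < tau * n%:R by rewrite mulr_gt0.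
have : 0 < (n1 n)%:R :> R by lra.
have : (n1 n)%:R < n%:R :> R by lra.
by rewrite ltr0n ltr_nat => -> ->.
Unshelve. all: by end_near. Qed.

Definition proj_vec n (w : T) : 'cV[R]_K :=
  \sum_(0 <= j < n) weight R n (n1 n) j *: vec (cgrade X) (X j w).

Lemma proj_vecE n w k : proj_vec n w k 0 = proj_sum X n (n1 n) k w.
Proof. by rewrite summxE; apply: eq_bigr => j _; rewrite !mxE. Qed.

Definition proj_stat n (w : T) : R := bform A (proj_vec n w) (proj_vec n w).

Lemma proj_stat_ge0 n w : 0 <= proj_stat n w.
Proof. exact: posdefmx_inv_ge0. Qed.

Lemma bmfun_proj_stat n : bmfun (proj_stat n).
Proof.
rewrite /proj_stat; under eq_fun do rewrite bformE.
apply: bmfun_sum => k _; apply: bmfun_sum => l _.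
under eq_fun do rewrite !proj_vecE.
apply: bmfunM; last exact: bmfun_proj_sum.
by apply: bmfunM; [exact: bmfun_proj_sum|exact: bmfun_cst].
Qed.

Lemma cvg_sqrt_invn : Num.sqrt (n%:R^-1 : R) @[n --> \oo] --> (0 : R).
Proof.
rewrite -[X in _ --> X]sqrtr0.
apply: (@cvg_comp _ _ _ (fun n => n%:R^-1 : R) (@Num.sqrt R) _ (nbhs (0 : R))).
  by apply/gtr0_cvgV0; [near=> n; rewrite ltr0n; near: n; exact: nbhs_infty_gt|
    exact: cvgr_idn].
exact: sqrt_continuous.
Unshelve. all: by end_near. Qed.

Lemma cvg_laplace_proj_stat (s : R) : 0 < s ->
  Ex P (fun w => expR (- (s * proj_stat n w))) @[n --> \oo] -->
  expR (- (K%:R / 2 * ln (1 + 2 * s))).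
Proof.
move=> s0; have uS := posdefmx_unit pdS.
have [C C0 HC] := @laplace_clt _ _ _ _ _ P X iidX [tuple 0 | _ < K] K (cgrade X)
  (Sigma X) A (measurable_cgrade X) (cgrade_le1 X) (Ex_cgrade iidX contF)
  (Ex_cgradeM iidX contF)
  (posdefmx_inv_sym pdS) (fun x => posdefmx_inv_ge0 x pdS) (mulVmx uS)
  s tau^-1 s0 ltac:(by rewrite invr_ge0 ltW).
apply/cvgrPdist_le => e e0.
have CN : 0 < e / (C + 1) by rewrite divr_gt0//; lra.
have small : \forall n \near \oo, `|0 - Num.sqrt (n%:R^-1 : R)| <= e / (C + 1).
  by have /cvgrPdist_le := cvg_sqrt_invn; apply.
apply: filterS2 near_balanced small => n [h h1 h2].
rewrite sub0r normrN ger0_norm ?sqrtr_ge0// => small_n.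
have n0 : (0 < n)%N by move: h => /andP[]; exact: ltn_trans.
rewrite distrC; apply: le_trans (HC n (weight R n (n1 n)) n0 _ _) _.
- exact: sum_weight_sqr.
- by move=> j _; exact: weight_sqr_le.
move: small_n; rewrite ler_pdivlMr; last lra.
by have := sqrtr_ge0 (n%:R^-1 : R); nra.
Qed.

(** The statistic is within [eps] of the quadratic form of the projection unless
    the empirical matrix or the change-point vector is [de]-far from its target,
    or the projection exceeds [B]. The function [G] dominates the indicator of
    this event by Markov-type bounds; its first two terms vanish as [n] grows,
    and the third is small by the choice of [B]. *)
Lemma test_stat_close (eps eta : R) : 0 < eps -> 0 < eta ->
  \forall n \near \oo,
    Ex P (fun w => (eps < `|test_stat X n1 c n w - proj_stat n w|)%R%:R) <= eta.
Proof.
move=> eps0 eta0; have uS := posdefmx_unit pdS.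
pose C0 := tau^-1; have C00 : 0 < C0 by rewrite invr_gt0.
(* [K * C0] bounds the second moment of the projection, so this choice makes
   the third term of [G] at most [eta / 2]. *)
pose B := Num.sqrt (2 * (K%:R * C0) / eta + 1).
have B2 : B ^+ 2 = 2 * (K%:R * C0) / eta + 1.
  by rewrite sqr_sqrtr// addr_ge0// divr_ge0 ?mulr_ge0// ltW.
have B20 : 0 < B ^+ 2.
  by rewrite B2 ltr_wpDl// divr_ge0 ?mulr_ge0// ltW.
have B0 : 0 <= B by exact: sqrtr_ge0.
have KB : K%:R * C0 / B ^+ 2 <= eta / 2.
  rewrite ler_pdivrMr// B2 mulrDr.
  have -> : eta / 2 * (2 * (K%:R * C0) / eta) = K%:R * C0.
    by field; rewrite gt_eqF.
  by rewrite lerDl mulr1 divr_ge0// ltW.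
have [de de0 H] := near_quadratic uS B0 eps0.
pose D := de^-1 * ((K * K)%:R * 6) + de ^- 2 * (K%:R * 9) + 1.
have D0 : 0 < D.
  by rewrite ltr_wpDl// addr_ge0// mulr_ge0 ?invr_ge0 ?exprn_ge0 ?mulr_ge0// ltW.
have eD : 0 < eta / 2 / D by rewrite !divr_gt0.
have m0 : 0 < Num.min (eta / 2 / D) 1 by rewrite lt_min eD ltr01.
have small : \forall n \near \oo,
    `|0 - Num.sqrt (n%:R^-1 : R)| <= Num.min (eta / 2 / D) 1.
  by have /cvgrPdist_le := cvg_sqrt_invn; apply.
apply: filterS2 near_balanced small => n [h h1 h2] small_n.
have n1n : (n1 n <= n)%N by move: h => /andP[_ /ltnW].
have n0 : (0 < n)%N by move: h => /andP[]; exact: ltn_trans.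
pose dS w k l := `|hatSigma (fun i => X i w) n k l - Sigma X k l|.
pose dU w k := (change_point_vec (fun i => X i w) n (n1 n) k 0 -
  proj_sum X n (n1 n) k w) ^+ 2.
pose S w k := proj_sum X n (n1 n) k w ^+ 2.
have bdS k l : bmfun (fun w => dS w k l).
  by apply: bmfun_norm; apply: bmfunB; [exact: bmfun_hatSigma|exact: bmfun_cst].
have bdU k : bmfun (fun w => dU w k).
  apply: bmfunX; apply: bmfunB; last exact: bmfun_proj_sum.
  exact: bmfun_change_point_vec.
have bS k : bmfun (fun w => S w k) by apply: bmfunX; exact: bmfun_proj_sum.
pose G1 w := \sum_k \sum_l dS w k l; pose G2 w := \sum_k dU w k.
pose G3 w := \sum_k S w k.
have bG1 : bmfun G1 by do 2 apply: bmfun_sum => ? _.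
have bG2 : bmfun G2 by apply: bmfun_sum.
have bG3 : bmfun G3 by apply: bmfun_sum.
have dU0 w k : 0 <= dU w k by rewrite /dU sqr_ge0.
have S0 w k : 0 <= S w k by rewrite /S sqr_ge0.
have dS0 w k l : 0 <= dS w k l by rewrite /dS normr_ge0.
have G10 w : 0 <= G1 w by apply: sumr_ge0 => k _; apply: sumr_ge0 => l _; exact: dS0.
have G20 w : 0 <= G2 w by apply: sumr_ge0 => k _; exact: dU0.
have G30 w : 0 <= G3 w by apply: sumr_ge0 => k _; exact: S0.
have iv1 : 0 <= de^-1 by rewrite invr_ge0 ltW.
have iv2 : 0 <= de ^- 2 by rewrite invr_ge0 exprn_ge0// ltW.
have iv3 : 0 <= B ^- 2 by rewrite invr_ge0 ltW.
pose G w := de^-1 * G1 w + (de ^- 2 * G2 w + B ^- 2 * G3 w).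
have Gle w : (eps < `|test_stat X n1 c n w - proj_stat n w|)%R%:R <= G w.
  have q1 := mulr_ge0 iv1 (G10 w); have q2 := mulr_ge0 iv2 (G20 w).
  have q3 := mulr_ge0 iv3 (G30 w).
  case: ltP => [bad|_] /=; last by rewrite /G !addr_ge0.
  case: (leP 1 (G w)) => // G1'; exfalso.
  have gS k l : dS w k l < de.
    have : dS w k l <= G1 w.
      rewrite /G1 (bigD1 k)//= (bigD1 l)//= -addrA lerDl addr_ge0//.
        by apply: sumr_ge0 => l' _; exact: dS0.
      by apply: sumr_ge0 => k' _; apply: sumr_ge0 => l' _; exact: dS0.
    move=> /le_lt_trans; apply; rewrite -[de]mulr1 -ltr_pdivrMl//.
    by apply: le_lt_trans G1'; rewrite /G lerDl addr_ge0.
  have gU k : `|change_point_vec (fun i => X i w) n (n1 n) k 0 -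
      proj_vec n w k 0| < de.
    rewrite proj_vecE -(@ltr_pXn2r _ 2)// ?nnegrE ?(ltW de0)//.
    rewrite real_normK ?num_real//.
    have : dU w k <= G2 w.
      by rewrite /G2 (bigD1 k)//= lerDl; apply: sumr_ge0 => k' _; exact: dU0.
    move=> /le_lt_trans; apply; rewrite -[_ ^+ 2]mulr1 -ltr_pdivrMl ?exprn_gt0//.
    by apply: le_lt_trans G1'; rewrite /G addrCA lerDl addr_ge0.
  have gB k : `|proj_vec n w k 0| <= B.
    rewrite proj_vecE -(@ler_pXn2r _ 2)// ?nnegrE//.
    rewrite real_normK ?num_real//.
    have : S w k <= G3 w.
      by rewrite /G3 (bigD1 k)//= lerDl; apply: sumr_ge0 => k' _; exact: S0.
    move=> /le_trans; apply; rewrite -[_ ^+ 2]mulr1 -ler_pdivrMl//.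
    by apply: le_trans (ltW G1'); rewrite /G addrA lerDr addr_ge0.
  have [uM Hb] := H (hatSigma (fun i => X i w) n)
    (change_point_vec (fun i => X i w) n (n1 n)) (proj_vec n w) gS gU gB.
  move: bad; rewrite /test_stat /sample_stat uM ltNge => /negP; apply.
  exact: Hb.
apply: (@le_trans _ _ (Ex P G)).
  apply: Ex_le => //; last by apply: bmfunD; [|apply: bmfunD]; exact: bmfunZ.
  apply: bmfun_bool; apply: measurable_fun_ltr => //.
  apply: measurableT_comp => //; apply: measurable_funB.
    exact: measurable_test_stat.
  by have [] := bmfun_proj_stat n.
have b2 := bmfunZ (de ^- 2) bG2; have b3 := bmfunZ (B ^- 2) bG3.
rewrite /G ExD; [|exact: bmfunZ|exact: bmfunD].
rewrite (ExD P b2 b3) !ExZ//.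
set r := Num.sqrt (n%:R^-1 : R).
have E1 : Ex P G1 <= (K * K)%:R * (6 * r).
  rewrite Ex_sum; last by move=> k _; exact: bmfun_sum.
  apply: (@le_trans _ _ (\sum_(k < K) \sum_(l < K) (6 * r))).
    apply: ler_sum => k _; rewrite Ex_sum//; apply: ler_sum => l _.
    exact: Ex_norm_hatSigma_error.
  by rewrite !sumr_const card_ord -mulrnA [leRHS]mulr_natl.
have r2 : r ^+ 2 = n%:R^-1 by rewrite sqr_sqrtr// invr_ge0.
have E2 : Ex P G2 <= K%:R * (9 * r ^+ 2).
  rewrite Ex_sum//; apply: (@le_trans _ _ (\sum_(k < K) (9 * r ^+ 2))).
    by apply: ler_sum => k _; rewrite r2; exact: Ex_sqr_projection_error.
  by rewrite sumr_const card_ord [leRHS]mulr_natl.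
have E3 : Ex P G3 <= K%:R * C0.
  rewrite Ex_sum//; apply: (@le_trans _ _ (\sum_(k < K) C0)).
    apply: ler_sum => k _; apply: Ex_sqr_weighted => //; first exact: ltW.
    by move=> j _; exact: weight_sqr_le.
  by rewrite sumr_const card_ord [leRHS]mulr_natl.
have r0 : 0 <= r by exact: sqrtr_ge0.
have rD : r <= eta / 2 / D /\ r <= 1.
  by move: small_n; rewrite sub0r normrN ger0_norm// le_min => /andP[].
have {}E1 : de^-1 * Ex P G1 <= de^-1 * ((K * K)%:R * 6) * r.
  by rewrite -!mulrA ler_wpM2l ?invr_ge0 ?(ltW de0).
have {}E2 : de ^- 2 * Ex P G2 <= de ^- 2 * (K%:R * 9) * r.
  rewrite -!mulrA ler_wpM2l ?invr_ge0 ?exprn_ge0 ?(ltW de0)//.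
  rewrite (le_trans E2)// ler_wpM2l// ler_wpM2l// expr2.
  by rewrite ler_piMl//; have [] := rD.
have {}E3 : B ^- 2 * Ex P G3 <= eta / 2.
  apply: le_trans KB; rewrite [leRHS]mulrC ler_wpM2l// invr_ge0 ltW//.
have : r * D <= eta / 2 by rewrite -ler_pdivlMr//; have [] := rD.
move: E1 E2 E3; rewrite /D mulrDr mulrDr mulr1.
rewrite (mulrC _ r) (mulrC _ r); lra.
Qed.

End limit.

Theorem theorem1 (d : measure_display) (T : measurableType d) (R : realType)
    (P : probability T R) (K : nat) (X : nat -> {RV P >-> K.-tuple R})
    (n1 : nat -> nat) (t1 : R) (c : nat -> {RV P >-> R}) :
  (1 <= K)%N ->
  iid X ->
  (forall k : 'I_K, continuous (cdf (coord_rv X 0 k))) ->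
  0 < t1 < 1 ->
  (n1 n)%:R / n%:R @[n --> \oo] --> t1 ->
  posdefmx (Sigma X) ->
  cvg_in_distribution (test_stat_rv X n1 c) (chi_square R K).
Proof.
move=> _ iidX contF t01 n1t pdS x cx.
have cF : {for x, continuous (fun y : R => fine (chi_square R K `]-oo, y]%classic))}.
  apply: fine_cvg; rewrite fineK.
    exact: cx.
  by rewrite fin_num_measure//; exact: measurable_itv.
have mx : measurable `]-oo, x]%classic by exact: measurable_itv.
have cdfE n : cdf (test_stat_rv X n1 c n) x =
    (Ex P (fun w => (test_stat X n1 c n w <= x)%R%:R))%:E.
  rewrite -Ex_bool//.
  by apply: measurable_fun_ler => //; exact: measurable_test_stat.
rewrite -[X in _ --> X]fineK; last by rewrite fin_num_measure.
apply/fine_cvgP; split; first by apply: nearW => n; rewrite cdfE.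
rewrite (_ : _ \o _ = fun n => Ex P (fun w => (test_stat X n1 c n w <= x)%R%:R)).
  exact: (cvg_cdf_chi_square (V := test_stat X n1 c) (bmfun_proj_stat X n1)
    (proj_stat_ge0 n1 pdS) (measurable_test_stat X n1 c)
    (cvg_laplace_proj_stat iidX contF t01 n1t pdS)
    (test_stat_close c iidX contF t01 n1t pdS) cF).
by apply/funext => n; rewrite /= cdfE.
Qed.
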